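(* Let $(M,g)$ and $(\bar M,\bar g)$ be Riemannian manifolds endowed with distributions $\mathcal D\subset TM$ of rank $d$ and $\bar{\mathcal D}\subset T\bar M$, respectively, and let $f:(M,g;\mathcal D)\to(\bar M,\bar g;\bar{\mathcal D})$ be an adapted isometric immersion, i.e. an isometric immersion with $f_*(\mathcal D)\subset\bar{\mathcal D}_{|f(M)}$. Let $k\ge 2$ and let $n_1,\dots,n_k\ge 1$ be integers with $\sum_i n_i=s\le d$. Then at every point of $M$ $$ \delta^+_{{\rm m},\mathcal D}(n_1,\ldots,n_k)\ \le\ \bar\delta^+_{{\rm m},\bar{\mathcal D}}(n_1,\ldots,n_k)+\frac{k-1}{2k}\begin{cases}\mathcal H_{\mathcal D}(s)^2, & \text{if } s<d,\\ \|\bar H_{\mathcal D}\|^2, & \text{if } s=d.\end{cases} $$ Equality holds at a point $x\in M$ if and only if there exist mutually orthogonal subspaces $V_1,\dots,V_k$ of $\mathcal D_x$ with $\dim V_i=n_i$ (so $\sum_i n_i=s$) such that, with $V=\bigoplus_{i=1}^k V_i$: $f$ is mixed totally geodesic on $V$; $\bar H_1=\cdots=\bar H_k$; $\|\bar H_V\|=\mathcal H_{\mathcal D_x}(s)$; and $\bar{\rm S}_{\rm m}(V_1,\dots,V_k)=\bar\delta^+_{{\rm m},\bar{\mathcal D}}(n_1,\dots,n_k)(x)$.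
   Context: $M$ is identified with its image $f(M)$; objects with a bar refer to $\bar M$, and quantities on $\bar M$ are evaluated at $f(x)$. A distribution is a subbundle of the tangent bundle. Mutual curvature: for mutually orthogonal subspaces $V_1,\dots,V_k$ ($k\ge2$) of $\mathcal D_x$, ${\rm S}_{\rm m}(V_1,\dots,V_k)=\sum_{i<j}\sum_{a,b}K(e_a\wedge e_b)$, where for each pair $i<j$ the vectors $e_a$ run over an orthonormal basis of $V_i$ and $e_b$ over an orthonormal basis of $V_j$, and $K$ is the sectional curvature of $(M,g)$ (independent of the choice of bases). $\bar{\rm S}_{\rm m}$ is the same quantity computed with the sectional curvature of $(\bar M,\bar g)$. $\delta^+_{{\rm m},\mathcal D}(n_1,\dots,n_k)(x)=\max {\rm S}_{\rm m}(V_1,\dots,V_k)$, where $V_1,\dots,V_k$ run over all $k$ mutually orthogonal subspaces of $\mathcal D_x$ with $\dim V_i=n_i$. $\bar\delta^+_{{\rm m},\bar{\mathcal D}}(n_1,\dots,n_k)$ is the analogous invariant of $(\bar M,\bar g;\bar{\mathcal D})$. $\bar h:TM\times TM\to TM^\perp$ is the second fundamental form of the immersion. For a subspace $V\subset\mathcal D_x$, $\bar H_V=\sum_i\bar h(e_i,e_i)$ with $\{e_i\}$ an orthonormal basis of $V$; $\bar H_i=\bar H_{V_i}$; $\bar H_{\mathcal D}$ at $x$ is $\bar H_{\mathcal D_x}$. No normalization by dimension is used. $\mathcal H_{\mathcal D}(s)$ at $x$, also written $\mathcal H_{\mathcal D_x}(s)$, is $\max\{\|\bar H_V\| : V\subset\mathcal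 D_x,\ \dim V=s\}$. $f$ is mixed totally geodesic on $V=\bigoplus_{i=1}^kV_i$ if $\bar h(X,Y)=0$ for all $X\in V_i$, $Y\in V_j$, $i\neq j$. *)

(* Defs.v *)
From HB Require Import structures.
From mathcomp Require Import all_boot all_order all_algebra.
From mathcomp Require Import all_classical all_reals all_analysis.

Set Implicit Arguments.
Unset Strict Implicit.
Unset Printing Implicit Defensive.

Import Order.TTheory GRing.Theory Num.Theory.
Import numFieldNormedType.Exports.

Local Open Scope classical_set_scope.
Local Open Scope ring_scope.

(* The standard notion for open U, which is how it is used below. *)
Fixpoint Ck_on (R : realType) (V W : normedModType R) (k : nat) (U : set V)
    (F : V -> W) : Prop :=
  if k is k'.+1 then
    (forall y, U y -> differentiable F y) /\
    (forall v : V, Ck_on k' U ('D_v F))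
  else forall y, U y -> {for y, continuous F}.

Definition smooth_on (R : realType) (V W : normedModType R) (U : set V)
    (F : V -> W) : Prop :=
  forall k, Ck_on k U F.

(* [param] is the inverse of [coord] on the image of [dom]; its values off that
   image are irrelevant. *)
Record chart (R : realType) (T : topologicalType) (m : nat) := Chart {
  dom : set T;
  coord : T -> 'rV[R]_m;
  param : 'rV[R]_m -> T;
  dom_open : open dom;
  image_open : open (coord @` dom);
  coordK : forall x, dom x -> param (coord x) = x;
  coord_continuous : forall x, dom x -> {for x, continuous coord};
  param_continuous :
    forall y, (coord @` dom) y -> {for y, continuous param} }.

Record manifold (R : realType) (m : nat) := Manifold {
  carrier :> topologicalType;
  manifold_hausdorff : hausdorff_space carrier;
  manifold_second_countable : @second_countable carrier;
  chart_index : Type;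
  atlas : chart_index -> chart R carrier m;
  atlas_cover : forall x, exists i, dom (atlas i) x;
  atlas_smooth : forall i j,
    smooth_on (coord (atlas i) @` (dom (atlas i) `&` dom (atlas j)))
      (coord (atlas j) \o param (atlas i)) }.

Section LocalGeometry.
Context {R : realType}.

(* Throughout, a tangent vector at a point of a chart is the row vector of its
   components in the coordinate frame of that chart, and a differential acts
   through [diff]. *)

Definition ip m (A : 'M[R]_m) (u v : 'rV[R]_m) : R := (u *m A *m v^T) 0 0.

Definition vnorm m (A : 'M[R]_m) (u : 'rV[R]_m) : R := Num.sqrt (ip A u u).

(* Koszul formula for constant-coefficient fields: [christoffel G y u v] is the
   vector whose G-inner product with the l-th coordinate vector is the entry l
   of the row below, i.e. its k-th component is Gamma^k_ij u^i v^j. *)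
Definition christoffel m (G : 'rV[R]_m -> 'M[R]_m) (y u v : 'rV[R]_m) :
    'rV[R]_m :=
  (\row_l (2^-1 *
     ('D_u (fun z => ip (G z) v (delta_mx 0 l)) y
      + 'D_v (fun z => ip (G z) u (delta_mx 0 l)) y
      - 'D_(delta_mx 0 l) (fun z => ip (G z) u v) y)))
  *m invmx (G y).

(* Levi-Civita derivative of the field Y along the constant field u. *)
Definition nabla m (G : 'rV[R]_m -> 'M[R]_m) (u : 'rV[R]_m)
    (Y : 'rV[R]_m -> 'rV[R]_m) : 'rV[R]_m -> 'rV[R]_m :=
  fun y => 'D_u Y y + christoffel G y u (Y y).

(* R(u,v)w; there is no bracket term since constant fields commute. *)
Definition riemann m (G : 'rV[R]_m -> 'M[R]_m) (y u v w : 'rV[R]_m) :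
    'rV[R]_m :=
  nabla G u (nabla G v (cst w)) y - nabla G v (nabla G u (cst w)) y.

Definition sectional m (G : 'rV[R]_m -> 'M[R]_m) (y u v : 'rV[R]_m) : R :=
  ip (G y) (riemann G y u v v) u /
  (ip (G y) u u * ip (G y) v v - ip (G y) u v ^+ 2).

(* Covariant derivative, in the direction u, of a field W along the map F. *)
Definition nabla_along m p (G : 'rV[R]_p -> 'M[R]_p)
    (F : 'rV[R]_m -> 'rV[R]_p) (u : 'rV[R]_m) (W : 'rV[R]_m -> 'rV[R]_p)
    (y : 'rV[R]_m) : 'rV[R]_p :=
  'D_u W y + christoffel G (F y) ('d F y u) (W y).

(* Gauss formula, for the constant fields u and v. *)
Definition second_ff_loc m p (G : 'rV[R]_m -> 'M[R]_m)
    (Gb : 'rV[R]_p -> 'M[R]_p) (F : 'rV[R]_m -> 'rV[R]_p)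
    (y u v : 'rV[R]_m) : 'rV[R]_p :=
  nabla_along Gb F u (fun z => 'd F z v) y - 'd F y (nabla G u (cst v) y).

Definition orthonormal_basis m (A : 'M[R]_m) (V : {vspace 'rV[R]_m})
    (e : seq 'rV[R]_m) : Prop :=
  basis_of V e /\
  forall a b, (a < size e)%N -> (b < size e)%N ->
    ip A e`_a e`_b = (a == b)%:R.

(* A choice of orthonormal basis; the quantities below do not depend on it. *)
Definition onb m (A : 'M[R]_m) (V : {vspace 'rV[R]_m}) : seq 'rV[R]_m :=
  xget [::] [set e | orthonormal_basis A V e].

Definition orth_family m (A : 'M[R]_m) (W : {vspace 'rV[R]_m}) k
    (n : 'I_k -> nat) (V : 'I_k -> {vspace 'rV[R]_m}) : Prop :=
  [/\ forall i, (V i <= W)%VS,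
      forall i, \dim (V i) = n i &
      forall i j, i != j -> forall u v, u \in V i -> v \in V j ->
        ip A u v = 0].

End LocalGeometry.

Section Manifolds.
Context {R : realType}.

Definition chart_image m (M : manifold R m) (i : chart_index M) : set 'rV[R]_m :=
  coord (atlas i) @` dom (atlas i).

Definition overlap m (M : manifold R m) (i j : chart_index M) : set 'rV[R]_m :=
  coord (atlas i) @` (dom (atlas i) `&` dom (atlas j)).

Definition transition m (M : manifold R m) (i j : chart_index M) :
    'rV[R]_m -> 'rV[R]_m :=
  coord (atlas j) \o param (atlas i).

(* A Riemannian metric, given by its Gram matrices in the charts. *)
Record metric m (M : manifold R m) := Metric {
  gram : chart_index M -> 'rV[R]_m -> 'M[R]_m;
  gram_smooth : forall i, smooth_on (chart_image i) (gram i);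
  gram_sym : forall i y, chart_image i y -> (gram i y)^T = gram i y;
  gram_posdef : forall i y, chart_image i y ->
    forall u, u != 0 -> 0 < ip (gram i y) u u;
  gram_transition : forall i j y, overlap i j y -> forall u v,
    ip (gram i y) u v =
    ip (gram j (transition i j y))
       ('d (transition i j) y u) ('d (transition i j) y v) }.

(* A distribution of rank d, given by its fibres in the charts. *)
Record tangent_distribution m (M : manifold R m) (d : nat) := Distribution {
  fibre : chart_index M -> 'rV[R]_m -> {vspace 'rV[R]_m};
  fibre_rank : forall i y, chart_image i y -> \dim (fibre i y) = d;
  fibre_transition : forall i j y, overlap i j y -> forall u,
    (u \in fibre i y) =
    ('d (transition i j) y u \in fibre j (transition i j y));
  fibre_smooth : forall i y0, chart_image i y0 ->
    exists U : set 'rV[R]_m, exists X : 'I_d -> 'rV[R]_m -> 'rV[R]_m,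
      [/\ open U, U y0, U `<=` chart_image i,
          forall a, smooth_on U (X a) &
          forall y, U y -> fibre i y = <<[seq X a y | a <- enum 'I_d]>>%VS] }.

(* From here on x is a point and i a chart of M around x; the subspaces of the
   tangent space at x are read in that chart. *)

Definition gram_at m (M : manifold R m) (g : metric M) (i : chart_index M) (x : M) :=
  gram g i (coord (atlas i) x).

Definition fibre_at m (M : manifold R m) d (D : tangent_distribution M d)
    (i : chart_index M) (x : M) :=
  fibre D i (coord (atlas i) x).

Definition mutual_curvature m (M : manifold R m) (g : metric M)
    (i : chart_index M) (x : M) k (V : 'I_k -> {vspace 'rV[R]_m}) : R :=
  \sum_(a < k) \sum_(b < k | (a < b)%N)
    \sum_(u <- onb (gram_at g i x) (V a))
      \sum_(v <- onb (gram_at g i x) (V b))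
        sectional (gram g i) (coord (atlas i) x) u v.

(* The supremum is a maximum, by compactness, as soon as the n_i add up to at
   most the rank of D. *)
Definition mutual_delta m (M : manifold R m) (g : metric M) d
    (D : tangent_distribution M d) (i : chart_index M) (x : M) k (n : 'I_k -> nat) : R :=
  sup [set mutual_curvature g i x V |
        V in orth_family (gram_at g i x) (fibre_at D i x) n].

(* From here on j is a chart of Mb around f x. *)

Definition local_rep m p (M : manifold R m) (Mb : manifold R p) (f : M -> Mb)
    (i : chart_index M) (j : chart_index Mb) : 'rV[R]_m -> 'rV[R]_p :=
  coord (atlas j) \o f \o param (atlas i).

Definition diff_at m p (M : manifold R m) (Mb : manifold R p) (f : M -> Mb)
    (i : chart_index M) (j : chart_index Mb) (x : M) : {linear 'rV[R]_m -> 'rV[R]_p} :=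
  'd (local_rep f i j) (coord (atlas i) x).

Definition smooth_map m p (M : manifold R m) (Mb : manifold R p)
    (f : M -> Mb) : Prop :=
  continuous f /\
  forall i j,
    smooth_on (coord (atlas i) @` (dom (atlas i) `&` f @^-1` dom (atlas j)))
      (local_rep f i j).

Definition immersion m p (M : manifold R m) (Mb : manifold R p)
    (f : M -> Mb) : Prop :=
  smooth_map f /\
  forall i j x, dom (atlas i) x -> dom (atlas j) (f x) ->
    injective (diff_at f i j x).

Definition isometric m p (M : manifold R m) (g : metric M)
    (Mb : manifold R p) (gb : metric Mb) (f : M -> Mb) : Prop :=
  forall i j x, dom (atlas i) x -> dom (atlas j) (f x) -> forall u v,
    ip (gram_at gb j (f x)) (diff_at f i j x u) (diff_at f i j x v) =
    ip (gram_at g i x) u v.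

Definition adapted m p (M : manifold R m) d (D : tangent_distribution M d)
    (Mb : manifold R p) db (Db : tangent_distribution Mb db) (f : M -> Mb) : Prop :=
  forall i j x, dom (atlas i) x -> dom (atlas j) (f x) -> forall u,
    u \in fibre_at D i x -> diff_at f i j x u \in fibre_at Db j (f x).

Definition adapted_isometric_immersion m p (M : manifold R m) (g : metric M)
    d (D : tangent_distribution M d) (Mb : manifold R p) (gb : metric Mb)
    db (Db : tangent_distribution Mb db) (f : M -> Mb) : Prop :=
  [/\ immersion f, isometric g gb f & adapted D Db f].

Definition push m p (M : manifold R m) (Mb : manifold R p) (f : M -> Mb)
    (i : chart_index M) (j : chart_index Mb) (x : M) (V : {vspace 'rV[R]_m}) :
    {vspace 'rV[R]_p} :=
  (linfun (diff_at f i j x) @: V)%VS.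

Definition second_ff m p (M : manifold R m) (g : metric M)
    (Mb : manifold R p) (gb : metric Mb) (f : M -> Mb)
    (i : chart_index M) (j : chart_index Mb) (x : M) (u v : 'rV[R]_m) : 'rV[R]_p :=
  second_ff_loc (gram g i) (gram gb j) (local_rep f i j)
    (coord (atlas i) x) u v.

Definition mean_curv m p (M : manifold R m) (g : metric M)
    (Mb : manifold R p) (gb : metric Mb) (f : M -> Mb)
    (i : chart_index M) (j : chart_index Mb) (x : M) (V : {vspace 'rV[R]_m}) : 'rV[R]_p :=
  \sum_(e <- onb (gram_at g i x) V) second_ff g gb f i j x e e.

Definition mean_curv_norm m p (M : manifold R m) (g : metric M)
    (Mb : manifold R p) (gb : metric Mb) (f : M -> Mb)
    (i : chart_index M) (j : chart_index Mb) (x : M) (V : {vspace 'rV[R]_m}) : R :=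
  vnorm (gram_at gb j (f x)) (mean_curv g gb f i j x V).

(* Again a maximum, by compactness, when s is at most the rank of D. *)
Definition max_mean_curv m p (M : manifold R m) (g : metric M)
    d (D : tangent_distribution M d) (Mb : manifold R p) (gb : metric Mb)
    (f : M -> Mb) (i : chart_index M) (j : chart_index Mb) (x : M) (s : nat) : R :=
  sup [set mean_curv_norm g gb f i j x V |
        V in [set V : {vspace 'rV[R]_m} |
               (V <= fibre_at D i x)%VS /\ \dim V = s]].

Definition mixed_totally_geodesic m p (M : manifold R m) (g : metric M)
    (Mb : manifold R p) (gb : metric Mb) (f : M -> Mb)
    (i : chart_index M) (j : chart_index Mb) (x : M) k
    (V : 'I_k -> {vspace 'rV[R]_m}) : Prop :=
  forall a b, a != b -> forall u v, u \in V a -> v \in V b ->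
    second_ff g gb f i j x u v = 0.

End Manifolds.

(* Main.v *)
(* The Gauss equation gives, for orthonormal u and v,
     K(u, v) = Kb(u, v) + <h(u,u), h(v,v)> - |h(u,v)|^2.
   Summing over orthonormal bases of V_1, .., V_k, with H_a the trace of h on V_a
   and H the trace on their sum,
     Sm(V) = Smb(V) + sum_(a<b) <H_a, H_b> - sum_(a<b) sum |h(e_a, e_b)|^2,
     sum_(a<b) <H_a, H_b> =
       (k-1)/(2k) |H|^2 - 1/(4k) sum_(a,b) |H_a - H_b|^2.
   So Sm(V) <= Smb(V) + (k-1)/(2k) |H|^2, with equality iff f is mixed totally
   geodesic on V and H_1 = .. = H_k.  The suprema are attained because the
   orthonormal frames of the fibre form a compact set on which all these
   quantities are polynomial.
   The Gauss equation itself is obtained in coordinates from the connection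
   pulled back along f, whose torsion vanishes by the symmetry of second
   derivatives and whose metric compatibility identifies its tangential part
   with the Levi-Civita connection of M. *)
From HB Require Import structures.
Require Import Defs.
From mathcomp Require Import all_boot all_order all_algebra.
From mathcomp Require Import all_classical all_reals all_analysis.
From mathcomp Require Import ring lra.

Set Implicit Arguments.
Unset Strict Implicit.
Unset Printing Implicit Defensive.

Import Order.TTheory GRing.Theory Num.Theory.
Import numFieldNormedType.Exports.

Local Open Scope classical_set_scope.
Local Open Scope ring_scope.

(** For a single family V the gap to the bound splits into three nonnegative slacks: the Gauss
    defect, the distance of Smb from its maximum, and a positive multiple of the distance of |H|^2
    from its bound. A maximizing family closes all three exactly under the four listed conditions,
    so equality of suprema is read off at an attained maximum. When s = d the fibre is the only
    subspace of dimension s, so the maximal mean curvature is |H_D| and both cases share one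
    equality condition. Two constraints shape the local part. The connection formulas hold only over
    an open set of coordinates, so any identity that is differentiated later must be proved on a
    neighbourhood, not merely at the point. Moreover traces are taken over an arbitrarily chosen
    orthonormal basis; separate linearity of curvature and of h is what makes them independent of
    that choice and also continuous on frames. *)

Lemma linear_comb (R : nzRingType) (V W : lmodType R) (f : V -> W) I (r : seq I)
    (c : I -> R) (x : I -> V) :
  linear f -> f (\sum_(i <- r) c i *: x i) = \sum_(i <- r) c i *: f (x i).
Proof.
(* Linearity comes as a proof about maps depending on a point, so the bundled structure is built on
   the spot. *)
move=> lf; pose fM := GRing.isLinear.Build _ _ _ _ f lf.
pose g : {linear V -> W} := HB.pack f fM.
by rewrite -[LHS]/(g _) linear_sum; apply: eq_bigr => i _; rewrite linearZ.
Qed.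

(** * Differential calculus *)

Section Calculus.
Context {R : realType}.

Lemma derive_eq_on (V W : normedModType R) (U : set V) (f g : V -> W) y u :
  open U -> U y -> (forall z, U z -> f z = g z) -> 'D_u f y = 'D_u g y.
Proof.
move=> oU Uy fg; apply: near_eq_derive.
by apply: filterS (open_nbhs_nbhs (conj oU Uy)) => z /fg.
Qed.

(** Both functions share the first-order expansion at [y], so ['d f y] also serves [g]; uniqueness
    of the differential identifies it with ['d g y]. *)
Lemma differentiable_eq_on (V W : normedModType R) (U : set V)
    (f g : V -> W) y :
  open U -> U y -> (forall z, U z -> f z = g z) ->
  differentiable f y -> differentiable g y.
Proof.
move=> oU Uy fg df.
have [cdf ef] := (diff_locallyP _ _).1 df.
suff eg : g \o shift y = cst (g y) + 'd f y +o_ 0 id.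
  by apply/diff_locallyP; rewrite (diff_unique cdf eg).
apply/eqaddoP => e e0.
move: ef => /eqaddoP /(_ e e0) ef.
have nU : \forall z \near (0 : V), U (z + y).
  have c : z + y @[z --> (0 : V)] --> 0 + y by apply: cvgD;
    [exact: cvg_id|exact: cvg_cst].
  by rewrite add0r in c; apply: c; exact: open_nbhs_nbhs (conj oU Uy).
near=> h.
have <- : (f \o shift y - (cst (f y) + 'd f y)) h =
  (g \o shift y - (cst (g y) + 'd f y)) h.
  rewrite !fctE /= fg; last by near: h.
  by rewrite /shift/= fg.
by near: h.
Unshelve. all: by end_near. Qed.

(** Scaling is a continuous bilinear map, so this is the chain rule through the pair of [f] and
    [g]. *)
Lemma differentiable_scale (V W : normedModType R) (f : V -> R) (g : V -> W) y :
  differentiable f y -> differentiable g y ->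
  differentiable (fun z => f z *: g z) y /\
  forall u, 'D_u (fun z => f z *: g z) y = 'D_u f y *: g y + f y *: 'D_u g y.
Proof.
move=> df dg.
have bil : bilinear_for
    (GRing.Scale.Law.clone _ _ *:%R _) (GRing.Scale.Law.clone _ _ *:%R _)
    (fun (k : R) (w : W) => k *: w).
  split=> [w|k] a x z /=; first by rewrite scalerDl scalerA.
  by rewrite scalerDr !scalerA mulrC.
pose bM := bilinear_isBilinear.Build R R W W _ _ _ bil.
pose b : {bilinear R -> W -> W} := HB.pack (fun (k : R) (w : W) => k *: w) bM.
have cb : continuous (fun p : R * W => b p.1 p.2).
  by move=> p; exact: scale_continuous.
pose h := fun z => (f z, g z).
have dh : differentiable h y := differentiable_pair df dg.
have db : differentiable (fun p : R * W => b p.1 p.2) (h y) := differentiable_bilin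
  (h y) cb.
have dc : differentiable ((fun p : R * W => b p.1 p.2) \o h) y by exact:
  differentiable_comp.
split; first exact: dc.
move=> u; transitivity ('d (fun p : R * W => b p.1 p.2) (h y) ('d h y u)).
  by rewrite -[RHS]/(('d (fun p : R * W => b p.1 p.2) (h y) \o 'd h y) u)
    -diff_comp// -deriveE.
rewrite (diff_bilin (h y) cb) (diff_pair df dg) /= addrC.
by rewrite -!deriveE.
Qed.

Lemma differentiable_bigsum (V W : normedModType R) (I : Type) (r : seq I)
    (f : I -> V -> W) y :
  (forall i, differentiable (f i) y) ->
  differentiable (fun z => \sum_(i <- r) f i z) y /\
  forall u, 'D_u (fun z => \sum_(i <- r) f i z) y = \sum_(i <- r) 'D_u (f i) y.
Proof.
move=> df; elim: r => [|i r [IH IHD]].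
  under eq_fun do rewrite big_nil.
  by split=> [|u]; [exact: differentiable_cst|rewrite big_nil derive_cst].
under eq_fun do rewrite big_cons.
split=> [|u]; first exact: differentiableD.
rewrite big_cons -IHD.
by rewrite -deriveD//; exact: diff_derivable.
Qed.

Lemma differentiable_prod (V : normedModType R) (I : Type) (r : seq I)
    (f : I -> V -> R) y :
  (forall i, differentiable (f i) y) ->
  differentiable (fun z => \prod_(i <- r) f i z) y.
Proof.
move=> df; elim: r => [|i r IH].
  by under eq_fun do rewrite big_nil; exact: differentiable_cst.
under eq_fun do rewrite big_cons.
exact: differentiableM.
Qed.

Lemma differentiable_mx (V : normedModType R) m n (A : V -> 'M[R]_(m, n)) y :
  (forall i j, differentiable (fun z => A z i j) y) -> differentiable A y.
Proof.
move=> dA.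
rewrite (_ : A = fun z => \sum_i \sum_j A z i j *: delta_mx i j); last first.
  by apply/funext => z; exact: matrix_sum_delta.
apply: (differentiable_bigsum _ _).1 => i.
apply: (differentiable_bigsum _ _).1 => j.
exact: differentiableZl.
Qed.

Lemma differentiable_entry (V : normedModType R) m n (A : V -> 'M[R]_(m, n)) y i j :
  differentiable A y -> differentiable (fun z => A z i j) y.
Proof.
move=> dA; have dc := @differentiable_coord R _ _ (A y) i j.
exact: (differentiable_comp dA dc).
Qed.

Lemma derive_entry (V : normedModType R) m n (A : V -> 'M[R]_(m, n)) y u i j :
  differentiable A y -> 'D_u A y i j = 'D_u (fun z => A z i j) y.
Proof. by move=> dA; rewrite derive_mx ?mxE//; exact: diff_derivable. Qed.

(** Product rule for a moving linear map applied to a moving vector, by expanding the vector in the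
    standard basis. Only the values at fixed vectors must be differentiable; using it once per slot
    handles every multilinear expression below. *)
Lemma derive_lin (V W : normedModType R) n (U : set V)
    (L : V -> 'rV[R]_n -> W) (X : V -> 'rV[R]_n) y :
  open U -> U y ->
  (forall z, U z -> linear (L z)) ->
  (forall w, differentiable (L ^~ w) y) -> differentiable X y ->
  differentiable (fun z => L z (X z)) y /\
  forall u, 'D_u (fun z => L z (X z)) y = 'D_u (L ^~ (X y)) y + L y ('D_u X y).
Proof.
move=> oU Uy linL dL dX.
have lsum z c : U z ->
    L z (\row_a c a) = \sum_a c a *: L z (delta_mx 0 a).
  move=> Uz; rewrite (row_sum_delta (\row_a c a)) (linear_comb _ _ _ (linL z Uz)).
  by apply: eq_bigr => a _; rewrite mxE.
have rowE (v : 'rV[R]_n) : v = \row_a v 0 a by apply/rowP => a; rewrite mxE.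
have E z : U z -> L z (X z) = \sum_a X z 0 a *: L z (delta_mx 0 a).
  by move=> Uz; rewrite [X in L z X]rowE lsum.
have dXa a : differentiable (fun z => X z 0 a) y by exact: differentiable_entry.
have dS := fun a => differentiable_scale (dXa a) (dL (delta_mx 0 a)).
have [dB DB] := differentiable_bigsum (index_enum 'I_n) (fun a => (dS a).1).
split.
  by apply: differentiable_eq_on oU Uy _ dB => z Uz; rewrite E.
move=> u; rewrite (derive_eq_on u oU Uy E) DB.
rewrite (eq_bigr _ (fun a _ => (dS a).2 u)) big_split /= addrC; congr (_ + _).
  have E2 z : U z -> L z (X y) = \sum_a X y 0 a *: L z (delta_mx 0 a).
    by move=> Uz; rewrite [X in L z X]rowE lsum.
  rewrite (derive_eq_on u oU Uy E2).
  have dS2 a := differentiable_scale (differentiable_cst (X y 0 a) y) (dL (delta_mx 0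
    a)).
  have [_ DB2] := differentiable_bigsum (index_enum 'I_n) (fun a => (dS2 a).1).
  rewrite DB2; apply: eq_bigr => a _.
  by rewrite (dS2 a).2 derive_cst scale0r add0r.
rewrite [in RHS](rowE ('D_u X y)) lsum//; apply: eq_bigr => a _.
by rewrite derive_entry.
Qed.

Lemma differentiable_det (V : normedModType R) n (A : V -> 'M[R]_n) y :
  (forall i j, differentiable (fun z => A z i j) y) ->
  differentiable (fun z => \det (A z)) y.
Proof.
move=> dA; rewrite /determinant.
apply: (differentiable_bigsum _ _).1 => s.
by apply: differentiableM; [exact: differentiable_cst|exact: differentiable_prod].
Qed.

(** By Cramer's rule the entries of the inverse are quotients of polynomials in the entries. *)
Lemma differentiable_invmx (V : normedModType R) n (U : set V) (A : V -> 'M[R]_n) y :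
  open U -> U y -> (forall z, U z -> A z \in unitmx) -> differentiable A y ->
  differentiable (fun z => invmx (A z)) y.
Proof.
move=> oU Uy uA dA.
have dAij i j := differentiable_entry i j dA.
have dd := differentiable_det dAij.
have E z : U z -> (\det (A z))^-1 *: \adj (A z) = invmx (A z).
  by move=> Uz; rewrite /invmx uA.
apply: (differentiable_eq_on oU Uy E).
apply: (differentiable_scale _ _).1.
  apply: differentiableV => //.
  by move: (uA y Uy); rewrite unitmxE unitfE.
apply: differentiable_mx => i j; under eq_fun do rewrite mxE.
rewrite /cofactor.
apply: differentiableM; first exact: differentiable_cst.
apply: differentiable_det => a b; under eq_fun do rewrite !mxE.
exact: dAij.
Qed.

End Calculus.

(** * Symmetry of second derivatives *)

Section Schwarz.
Context {R : realType}.

Lemma is_derive_line (V W : normedModType R) (f : V -> W) (u c : V) (t : R) :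
  differentiable f (t *: u + c) ->
  is_derive t 1 (fun s : R => f (s *: u + c)) ('D_u f (t *: u + c)).
Proof.
move=> df; pose l := (fun s : R => s *: u + c).
have dl : is_diff t l ( *:%R^~ u).
  by rewrite -[X in is_diff _ _ X]addr0; exact: is_diffD.
have dl' : differentiable l t by exact: ex_diff.
have dc : differentiable (f \o l) t by exact: differentiable_comp.
apply: DeriveDef; first exact: (diff_derivable dc).
rewrite -[LHS]/('D_1 (f \o l) t) deriveE// diff_comp//= diff_val.
by rewrite scale1r deriveE.
Qed.

(* The mean value theorem, applied along [u] to [f (_ + t v) - f _]. *)
Lemma second_difference (V : normedModType R) (U : set V) (f : V -> R) y u v :
  open U -> U y -> (forall z, U z -> differentiable f z) ->
  differentiable ('D_u f) y ->
  forall e, 0 < e -> exists2 r, 0 < r & forall t, 0 < t -> t < r ->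
    `|f (t *: u + (t *: v + y)) - f (t *: u + y) - f (t *: v + y) + f y
      - t ^+ 2 * 'D_v ('D_u f) y| <= e * t ^+ 2.
Proof.
move=> oU Uy df dA e e0.
(* [t * K] bounds the displacements [a *: u + t *: v] for [a] between 0 and [t]; the added 1 keeps
   [K] positive. Two linearization errors of size [e / (2 * K) * (t * K)] then add up to [e * t],
   and the mean value theorem contributes the other factor [t]. *)
set A := 'D_u f; set K := `|u| + `|v| + 1.
have K0 : 0 < K by rewrite /K; have := normr_ge0 u; have := normr_ge0 v; lra.
have e'0 : 0 < e / (2 * K) by rewrite divr_gt0// mulr_gt0.
have := (diff_locallyP _ _).1 dA => -[_ /eqaddoP /(_ _ e'0) /nbhs_ballP [r1 r10 Hr1]].
have /nbhs_ballP [r2 r20 Hr2] := open_nbhs_nbhs (conj oU Uy).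
exists (Num.min r1 r2 / K).
  by rewrite divr_gt0// lt_min; apply/andP.
move=> t t0; rewrite ltr_pdivlMr// lt_min => /andP[tr1 tr2].
have bnd a : 0 <= a -> a <= t -> `|a *: u + t *: v| <= t * K /\ `|a *: u| <= t * K.
  move=> a0 at'; rewrite /K; have u0 := normr_ge0 u; have v0 := normr_ge0 v.
  have nau : `|a *: u| <= t * `|u| by rewrite normrZ ger0_norm// ler_wpM2r.
  have ntv : `|t *: v| = t * `|v| by rewrite normrZ gtr0_norm.
  have tv0 : 0 <= t * `|v| by rewrite mulr_ge0// ltW.
  split; last by nra.
  by apply: le_trans (ler_normD _ _) _; nra.
have inU h : `|h| <= t * K -> U (h + y).
  move=> hb; apply: Hr2; rewrite -ball_normE /= opprD addrCA subrr addr0 normrN.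
  exact: le_lt_trans hb tr2.
have est h : `|h| <= t * K -> `|A (h + y) - (A y + 'd A y h)| <= e / (2 * K) * (t * K).
  move=> hb; have := Hr1 h; rewrite -ball_normE /= sub0r normrN.
  move=> /(_ (le_lt_trans hb tr1)) H; apply: le_trans H _.
  by rewrite ler_wpM2l// ltW.
pose g := fun s : R => f (s *: u + (t *: v + y)) - f (s *: u + y).
pose dg := fun s : R => A (s *: u + (t *: v + y)) - A (s *: u + y).
have isd s : 0 <= s -> s <= t -> is_derive s 1 g (dg s).
  move=> s0 st; have [b1 b2] := bnd s s0 st.
  by apply: is_deriveB; apply: is_derive_line; apply: df; rewrite ?addrA; apply: inU.
have [||c cin Hc] := @MVT R g dg 0 t t0.
- by move=> s; rewrite in_itv /= => /andP[s0 st]; apply: isd; exact: ltW.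
- apply: derivable_within_continuous => s; rewrite in_itv /= => /andP[s0 st].
  by have [] := isd s s0 st.
move: cin; rewrite in_itv /= => /andP[c0 ct].
have [b1 b2] := bnd c (ltW c0) (ltW ct).
have E : f (t *: u + (t *: v + y)) - f (t *: u + y) - f (t *: v + y) + f y = g t - g 0.
  by rewrite /g !scale0r !add0r; ring.
rewrite E Hc subr0 /dg.
have e1 := est _ b1; have e2 := est _ b2.
rewrite deriveE//.
have dlin : 'd A y (c *: u + t *: v) = 'd A y (c *: u) + t * 'd A y v.
  by rewrite linearD [X in _ + X]linearZ.
rewrite addrA.
move: e1 e2; rewrite dlin.
rewrite (_ : e / (2 * K) * (t * K) = e / 2 * t); last by field; rewrite gt_eqF.
set a1 := A (c *: u + t *: v + y); set a2 := A (c *: u + y); set a0 := A y.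
set d1 := 'd A y (c *: u); set d2 := 'd A y v => e1 e2.
(* The increment of [A] from [c *: u] to [c *: u + t *: v] has linear part [t * d2]; what is left is
   the difference of the two linearization errors. *)
rewrite (_ : (a1 - a2) * t - t ^+ 2 * d2 =
  t * ((a1 - (a0 + (d1 + t * d2))) - (a2 - (a0 + d1)))); last by ring.
rewrite normrM gtr0_norm//.
have := ler_normB (a1 - (a0 + (d1 + t * d2))) (a2 - (a0 + d1)).
set x := `|_ - _|; move=> H; have : x <= e * t by lra.
by rewrite expr2 => ?; nra.
Qed.

(** The second difference of [f] is symmetric in [u] and [v], and each iterated derivative times
    [t ^+ 2] approximates it within [e / 2 * t ^+ 2]. *)
Lemma derive_sym_scalar (V : normedModType R) (U : set V) (f : V -> R) y u v :
  open U -> U y -> (forall z, U z -> differentiable f z) ->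
  differentiable ('D_u f) y -> differentiable ('D_v f) y ->
  'D_v ('D_u f) y = 'D_u ('D_v f) y.
Proof.
move=> oU Uy df du dv; apply/eqP; rewrite -subr_eq0 -normr_le0.
apply/ler_addgt0Pr => e e0; rewrite add0r.
have e20 : 0 < e / 2 by lra.
have [r1 r10 H1] := second_difference v oU Uy df du e20.
have [r2 r20 H2] := second_difference u oU Uy df dv e20.
pose t := Num.min r1 r2 / 2.
have m0 : 0 < Num.min r1 r2 by rewrite lt_min r10.
have t0 : 0 < t by rewrite /t; lra.
have : t < Num.min r1 r2 by rewrite /t; lra.
rewrite lt_min => /andP[/(H1 _ t0) + /(H2 _ t0)].
rewrite (addrCA (t *: v)).
set q := f (t *: u + _); set a := f (t *: u + y); set b := f (t *: v + y).
set c := f y; set X := 'D_v _ _; set Y := 'D_u _ _ => h1 h2.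
have t2 : 0 < t ^+ 2 by exact: exprn_gt0.
rewrite -(ler_pM2l t2) -[X in X * `|_|](gtr0_norm t2) -normrM.
rewrite (_ : t ^+ 2 * (X - Y) =
  (q - b - a + c - t ^+ 2 * Y) - (q - a - b + c - t ^+ 2 * X)); last by ring.
apply: le_trans (ler_normB _ _) _; apply: le_trans (lerD h2 h1) _.
by rewrite -mulrDl -splitr mulrC.
Qed.

Lemma derive_sym (V : normedModType R) m n (U : set V) (f : V -> 'M[R]_(m, n)) y u v :
  open U -> U y -> (forall z, U z -> differentiable f z) ->
  differentiable ('D_u f) y -> differentiable ('D_v f) y ->
  'D_v ('D_u f) y = 'D_u ('D_v f) y.
Proof.
move=> oU Uy df du dv; apply/matrixP => i j.
have E w z : U z -> 'D_w f z i j = 'D_w (fun x => f x i j) z.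
  by move=> Uz; apply: derive_entry; exact: df.
have dE w : differentiable ('D_w f) y -> differentiable ('D_w (fun x => f x i j)) y.
  move=> dw; apply: (differentiable_eq_on oU Uy (E w)).
  exact: differentiable_entry.
have {}E w w' : differentiable ('D_w f) y ->
    'D_w' ('D_w f) y i j = 'D_w' ('D_w (fun x => f x i j)) y.
  by move=> dw; apply: etrans (derive_entry w' i j dw) _;
    exact: derive_eq_on oU Uy (E w).
apply: etrans (E u v du) _; apply: etrans (esym (E v u dv)).
apply: derive_sym_scalar oU Uy _ (dE _ du) (dE _ dv) => z Uz.
exact/differentiable_entry/df.
Qed.

End Schwarz.

(** * Levi-Civita connection and Gauss equation in a chart *)

Section InnerProduct.
Context {R : realType} {m : nat}.
Implicit Types (A B : 'M[R]_m) (u v w : 'rV[R]_m).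

Lemma ipDl A u v w : ip A (u + v) w = ip A u w + ip A v w.
Proof. by rewrite /ip !mulmxDl mxE. Qed.
Lemma ipDr A u v w : ip A w (u + v) = ip A w u + ip A w v.
Proof. by rewrite /ip linearD mulmxDr mxE. Qed.
Lemma ipZl A a u w : ip A (a *: u) w = a * ip A u w.
Proof. by rewrite /ip -!scalemxAl mxE. Qed.
Lemma ipZr A a u w : ip A w (a *: u) = a * ip A w u.
Proof. by rewrite /ip linearZ /= -scalemxAr mxE. Qed.
Lemma ip_linm u v : linear (fun A => ip A u v : R).
Proof.
by move=> a A B; rewrite /ip mulmxDr mulmxDl -scalemxAr -scalemxAl !mxE.
Qed.
Lemma ip_linl A w : linear (fun u => ip A u w : R).
Proof. by move=> a u v; rewrite ipDl ipZl. Qed.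
Lemma ip_linr A u : linear (fun v => ip A u v : R).
Proof. by move=> a v w; rewrite ipDr ipZr. Qed.
Lemma ip0l A w : ip A 0 w = 0.
Proof. by rewrite -(scale0r 0) ipZl mul0r. Qed.
Lemma ip0r A w : ip A w 0 = 0.
Proof. by rewrite -(scale0r 0) ipZr mul0r. Qed.
Lemma ipNl A u w : ip A (- u) w = - ip A u w.
Proof. by rewrite -scaleN1r ipZl mulN1r. Qed.
Lemma ipBl A u v w : ip A (u - v) w = ip A u w - ip A v w.
Proof. by rewrite -scaleN1r ipDl ipZl mulN1r. Qed.
Lemma ipBr A u v w : ip A w (u - v) = ip A w u - ip A w v.
Proof. by rewrite -scaleN1r ipDr ipZr mulN1r. Qed.
Lemma ip_suml A I (r : seq I) (P : pred I) F w :
  ip A (\sum_(i <- r | P i) F i) w = \sum_(i <- r | P i) ip A (F i) w.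
Proof. exact: (big_morph (fun u => ip A u w) (fun u v => ipDl A u v w) (ip0l A w)). Qed.
Lemma ip_sumr A I (r : seq I) (P : pred I) F w :
  ip A w (\sum_(i <- r | P i) F i) = \sum_(i <- r | P i) ip A w (F i).
Proof. exact: (big_morph (fun u => ip A w u) (fun u v => ipDr A u v w) (ip0r A w)). Qed.

Lemma ipC A u v : A^T = A -> ip A u v = ip A v u.
Proof.
move=> sA; rewrite /ip; have -> : u *m A *m v^T = (v *m A *m u^T)^T.
  by rewrite !trmx_mul sA trmxK mulmxA.
by rewrite mxE.
Qed.

Definition gram_mx A := A^T = A /\ forall u, u != 0 -> 0 < ip A u u.

Lemma ip_ge0 A u : gram_mx A -> 0 <= ip A u u.
Proof.
move=> [_ pA]; have [->|/pA/ltW//] := eqVneq u 0; by rewrite ip0l.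
Qed.

Lemma ip_eq0 A u : gram_mx A -> ip A u u = 0 -> u = 0.
Proof.
by move=> [_ pA] e; apply/eqP; apply: contraT => /pA; rewrite e ltxx.
Qed.

Lemma ip_inj A u v : gram_mx A -> (forall w, ip A u w = ip A v w) -> u = v.
Proof.
move=> gA e; apply/eqP; rewrite -subr_eq0; apply/eqP/(ip_eq0 gA).
by rewrite ipBl e subrr.
Qed.

(** A row of the kernel pairs to zero with itself, hence vanishes. *)
Lemma gram_mx_unit A : gram_mx A -> A \in unitmx.
Proof.
move=> gA; rewrite -row_free_unit -kermx_eq0; apply/eqP/row_matrixP => i.
rewrite row0; apply: (ip_eq0 gA).
by rewrite /ip -row_mul mulmx_ker row0 mul0mx mxE.
Qed.

End InnerProduct.

(* Sealed copies of the directional derivative, of the Christoffel symbols and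
   of the curvature: comparing such terms otherwise unfolds limits and inverse
   matrices. *)
HB.lock Definition dd (R : realType) (V W : normedModType R) (u : V)
  (f : V -> W) (y : V) : W := 'D_u f y.
Arguments dd {R V W} u f y.

HB.lock Definition chr (R : realType) m (G : 'rV[R]_m -> 'M[R]_m)
  (y u v : 'rV[R]_m) : 'rV[R]_m := christoffel G y u v.
Arguments chr {R m} G y u v.

HB.lock Definition curv (R : realType) m (G : 'rV[R]_m -> 'M[R]_m)
  (y u v w : 'rV[R]_m) : 'rV[R]_m := riemann G y u v w.
Arguments curv {R m} G y u v w.

Lemma ddE (R : realType) (V W : normedModType R) (u : V) (F : V -> W) (y : V) :
  dd u F y = 'D_u F y.
Proof. by rewrite unlock. Qed.

Lemma chrE (R : realType) m (G : 'rV[R]_m -> 'M[R]_m) (y u v : 'rV[R]_m) :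
  chr G y u v = christoffel G y u v.
Proof. by rewrite unlock. Qed.

Section Smooth.
Context {R : realType} {V W : normedModType R}.
Implicit Types (U : set V) (F : V -> W).

Lemma smooth_on_differentiable U F y :
  smooth_on U F -> U y -> differentiable F y.
Proof. by move=> sF Uy; have [+ _] := sF 1%N; exact. Qed.

Lemma smooth_on_dd U F v : smooth_on U F -> smooth_on U (dd v F).
Proof.
move=> sF k; have -> : dd v F = 'D_v F by apply/funext => y; exact: ddE.
by have [_] := sF k.+1; exact.
Qed.

Lemma dd_eq_on U F F' y u :
  open U -> U y -> (forall z, U z -> F z = F' z) -> dd u F y = dd u F' y.
Proof. by rewrite !ddE; exact: derive_eq_on. Qed.

Lemma dd_cst (w : W) (u y : V) : dd u (cst w) y = 0.
Proof. by rewrite ddE derive_cst. Qed.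

Lemma dd_lin n U (L : V -> 'rV[R]_n -> W) (X : V -> 'rV[R]_n) y :
  open U -> U y ->
  (forall z, U z -> linear (L z)) ->
  (forall w, differentiable (L ^~ w) y) -> differentiable X y ->
  differentiable (fun z => L z (X z)) y /\
  forall u, dd u (fun z => L z (X z)) y = dd u (L ^~ (X y)) y + L y (dd u X y).
Proof.
move=> oU Uy linL dL dX; have [d D] := derive_lin oU Uy linL dL dX.
by split=> // u; rewrite !ddE D.
Qed.

Lemma dd_linear F y : differentiable F y -> linear (fun v => dd v F y).
Proof. by move=> dF a u v; rewrite !ddE !deriveE// linearP. Qed.

End Smooth.

Section DeriveIp.
Context {R : realType} {V : normedModType R} {m : nat}.

Lemma derive_mx_linear (n : nat) (l : 'M[R]_(m, n) -> R) (A : V -> 'M[R]_(m, n)) y :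
  linear l -> differentiable A y ->
  differentiable (fun z => l (A z)) y /\ forall u, dd u (fun z =>
    l (A z)) y = l (dd u A y).
Proof.
move=> ll dA.
have E B : l B = \sum_i \sum_j B i j *: l (delta_mx i j).
  rewrite [in LHS](matrix_sum_delta B).
  under eq_bigr do rewrite -[\sum_j _]scale1r.
  rewrite (linear_comb _ _ _ ll); apply: eq_bigr => i _.
  by rewrite scale1r (linear_comb _ _ _ ll).
have dS i j := differentiable_scale (differentiable_entry i j dA)
  (differentiable_cst (l (delta_mx i j)) y).
have dSS i := differentiable_bigsum (index_enum 'I_n) (fun j => (dS i j).1).
have [d D] := differentiable_bigsum (index_enum 'I_m) (fun i => (dSS i).1).
rewrite (_ : (fun z => l (A z)) = (fun z => \sum_i \sum_j A z i j *: l (delta_mx i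
  j))); last first.
  by apply/funext => z; rewrite E.
split=> // u; rewrite ddE D E; apply: eq_bigr => i _.
rewrite (dSS i).2; apply: eq_bigr => j _.
by rewrite (dS i j).2 derive_cst scaler0 addr0 ddE derive_entry.
Qed.

Lemma dd_ip (A : V -> 'M[R]_m) (X Y : V -> 'rV[R]_m) y :
  differentiable A y -> differentiable X y -> differentiable Y y ->
  differentiable (fun z => ip (A z) (X z) (Y z)) y /\
  forall u, dd u (fun z => ip (A z) (X z) (Y z)) y =
    ip (dd u A y) (X y) (Y y) + ip (A y) (dd u X y) (Y y) + ip (A y) (X y) (dd u Y y).
Proof.
move=> dA dX dY.
have d0 v w := derive_mx_linear (@ip_linm R m v w) dA.
have d1 w := dd_lin openT (I : setT y) (fun z _ => @ip_linl R m (A z) w) (fun v =>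
  (d0 v w).1) dX.
have [d2 D2] := dd_lin openT (I : setT y) (fun z _ =>
  @ip_linr R m (A z) (X z)) (fun v => (d1 v).1) dY.
by split=> // u; rewrite D2 (d1 _).2 (d0 _ _).2.
Qed.

Lemma dd_ip_cst (A : V -> 'M[R]_m) v w y :
  differentiable A y ->
  differentiable (fun z => ip (A z) v w) y /\
  forall u, dd u (fun z => ip (A z) v w) y = ip (dd u A y) v w.
Proof. by move=> dA; exact: derive_mx_linear (@ip_linm R m v w) dA. Qed.

Lemma differentiable_mulmx n q (A : V -> 'M[R]_(m, n)) (B : V -> 'M[R]_(n, q)) y :
  differentiable A y -> differentiable B y ->
  differentiable (fun z => A z *m B z) y.
Proof.
move=> dA dB; apply: differentiable_mx => i j; under eq_fun do rewrite mxE.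
apply: (differentiable_bigsum _ _).1 => k.
by apply: differentiableM; exact: differentiable_entry.
Qed.

Lemma dd_comp (V' W' : normedModType R) (f : V -> V') (g : V' -> W') y u :
  differentiable f y -> differentiable g (f y) ->
  dd u (fun z => g (f z)) y = dd (dd u f y) g (f y).
Proof.
move=> df dg; rewrite !ddE [RHS]deriveE//.
have dc : differentiable (g \o f) y by exact: differentiable_comp.
by rewrite -[LHS]/('D_u (g \o f) y) (deriveE u dc) (deriveE u df) diff_comp.
Qed.

End DeriveIp.

Definition riemannian_on (R : realType) m (U : set 'rV[R]_m) (G : 'rV[R]_m ->
  'M[R]_m) :=
  [/\ open U, smooth_on U G & forall y, U y -> gram_mx (G y)].

(** Linearity in each slot yields both continuity on frames and independence of traces from the
    orthonormal basis. *)
Definition quadrilinear (R : realType) (V : lmodType R) (Q : V -> V -> V -> V -> R) :=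
  [/\ forall b c d, linear (fun a => Q a b c d : R),
      forall a c d, linear (fun b => Q a b c d : R),
      forall a b d, linear (fun c => Q a b c d : R) &
      forall a b c, linear (fun d => Q a b c d : R)].

(** * Koszul formula and Levi-Civita connection *)

Section KoszulForm.
Context {R : realType} {m : nat}.
Variable D : 'rV[R]_m -> 'M[R]_m.

(** Right-hand side of the Koszul formula for constant fields, with [D u] standing for the
    derivative of the Gram matrix along [u]. *)
Definition koszul_form u v w := ip (D u) v w + ip (D v) u w - ip (D w) u v.

Hypothesis linD : linear D.

Lemma koszul_form_linr u v : linear (koszul_form u v : _ -> R).
Proof.
move=> a w z; rewrite /koszul_form !ipDr !ipZr linD.
have /= -> := ip_linm u v a (D w) (D z).
by rewrite /GRing.scale /=; ring.
Qed.

Lemma koszul_form_linm u w : linear (fun v => koszul_form u v w : R).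
Proof.
move=> a v z; rewrite /koszul_form !ipDr !ipDl !ipZr !ipZl linD.
have /= -> := ip_linm u w a (D v) (D z).
by rewrite /GRing.scale /=; ring.
Qed.

End KoszulForm.

Section LeviCivita.
Context {R : realType} {m : nat}.
Variables (U : set 'rV[R]_m) (G : 'rV[R]_m -> 'M[R]_m).
Variable rG : riemannian_on U G.

Let oU : open U. Proof. by case: rG. Qed.
Let sG : smooth_on U G. Proof. by case: rG. Qed.
Let gG y : U y -> gram_mx (G y). Proof. by case: rG => _ _; apply. Qed.
Let dG y : U y -> differentiable G y.
Proof. exact: smooth_on_differentiable. Qed.

Lemma derive_gram_sym u y : U y -> (dd u G y)^T = dd u G y.
Proof.
move=> Uy; apply/matrixP => i j; rewrite mxE.
rewrite ddE (derive_entry u j i (dG Uy)) (derive_entry u i j (dG Uy)).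
apply: derive_eq_on oU Uy _ => z Uz.
by have [sGz _] := gG Uz; rewrite -[in LHS]sGz mxE.
Qed.

(** Multiplying by [G y] cancels the inverse matrix in [christoffel] and leaves the Koszul form on
    coordinate vectors, which extends by linearity. Symmetry, linearity and metric compatibility of
    [chr] follow from this and nondegeneracy alone. *)
Lemma koszul y u v w : U y ->
  2 * ip (G y) (chr G y u v) w =
  koszul_form (fun z => dd z G y) u v w.
Proof.
move=> Uy; rewrite /ip chrE /christoffel mulmxKV ?gram_mx_unit//; last exact: gG.
rewrite mxE mulr_sumr.
have lk : linear (koszul_form (fun z => dd z G y) u v : _ -> R).
  by apply: koszul_form_linr; exact/dd_linear/dG.
rewrite [in RHS](row_sum_delta w) (linear_comb _ _ _ lk); apply: eq_bigr => l _.
rewrite !mxE /GRing.scale /= /koszul_form.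
rewrite -!ddE !(dd_ip_cst _ _ (dG Uy)).2 mulrA mulVKf ?pnatr_eq0//.
by rewrite mulrC.
Qed.

Let two_neq0 : (2 : R) != 0. Proof. by rewrite pnatr_eq0. Qed.

Lemma chrC y u v : U y -> chr G y u v = chr G y v u.
Proof.
move=> Uy; apply: (ip_inj (gG Uy)) => w; apply: (mulfI two_neq0).
rewrite (koszul u v w Uy) (koszul v u w Uy) /koszul_form.
rewrite (ipC u v (derive_gram_sym w Uy)); ring.
Qed.

Lemma chr_linr y u : U y -> linear (chr G y u).
Proof.
move=> Uy a v w; apply: (ip_inj (gG Uy)) => z; apply: (mulfI two_neq0).
rewrite ipDl ipZl mulrDr mulrCA.
rewrite (koszul u v z Uy) (koszul u w z Uy) (koszul u (a *: v + w) z Uy).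
exact: koszul_form_linm (dd_linear (dG Uy)) u z a v w.
Qed.

Lemma chr_linl y v : U y -> linear (chr G y ^~ v).
Proof.
by move=> Uy a u w; rewrite !(chrC _ v Uy) chr_linr.
Qed.

(** In the Koszul forms of [u, v, w] and [u, w, v] the derivatives along [v] and [w] cancel, and the
    one along [u] appears twice. *)
Lemma chr_compat y u v w : U y ->
  ip (dd u G y) v w =
  ip (G y) (chr G y u v) w + ip (G y) v (chr G y u w).
Proof.
move=> Uy; apply: (mulfI two_neq0).
rewrite mulrDr (ipC v _ (gG Uy).1) (koszul u v w Uy) (koszul u w v Uy) /koszul_form.
rewrite (ipC w v (derive_gram_sym u Uy)); ring.
Qed.

Lemma differentiable_chr y u v : U y ->
  differentiable (fun z => chr G z u v) y.
Proof.
move=> Uy; under eq_fun do rewrite chrE; apply: differentiable_mulmx; last first.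
  apply: differentiable_invmx oU Uy _ (dG Uy) => z Uz.
  exact/gram_mx_unit/gG.
apply: differentiable_mx => i l.
have dD a z : U z -> differentiable (dd a G) z.
  by move=> Uz; exact: (smooth_on_differentiable (smooth_on_dd a sG) Uz).
pose h z : R := 2^-1 * (ip (dd u G z) v (delta_mx 0 l)
  + ip (dd v G z) u (delta_mx 0 l) - ip (dd (delta_mx 0 l) G z) u v).
have dh : differentiable h y.
  have di a b c := (dd_ip_cst b c (dD a y Uy)).1.
  apply: differentiableM; first exact: differentiable_cst.
  by apply: differentiableB; [apply: differentiableD|]; exact: di.
apply: differentiable_eq_on oU Uy _ dh => z Uz.
by rewrite /h mxE -!ddE !(dd_ip_cst _ _ (dG Uz)).2.
Qed.

(** [chr] is linear in each vector slot over [U], so [dd_lin] applies twice; the first summand is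
    the chain rule through [F]. *)
Lemma dd_chr_along p (U' : set 'rV[R]_p) (F : 'rV[R]_p -> 'rV[R]_m)
    (X Y : 'rV[R]_p -> 'rV[R]_m) y :
  open U' -> U' y -> (forall z, U' z -> U (F z)) ->
  differentiable F y -> differentiable X y -> differentiable Y y ->
  differentiable (fun z => chr G (F z) (X z) (Y z)) y /\
  forall u, dd u (fun z => chr G (F z) (X z) (Y z)) y =
    dd (dd u F y) (fun q => chr G q (X y) (Y y)) (F y)
    + chr G (F y) (dd u X y) (Y y) + chr G (F y) (X y) (dd u Y y).
Proof.
move=> oU' Uy UF dF dX dY.
have dc v w : differentiable (fun q => chr G q v w) (F y).
  by apply: differentiable_chr; exact: UF.
have d0 v w : differentiable (fun z => chr G (F z) v w) y.
  exact: (differentiable_comp dF (dc v w)).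
have d1 w := dd_lin oU' Uy (fun z Uz => @chr_linl (F z) w (UF z Uz)) (fun v =>
  d0 v w) dX.
have [d2 D2] := dd_lin oU' Uy (fun z Uz => @chr_linr (F z) (X z) (UF z Uz)) (fun v =>
  (d1 v).1) dY.
by split=> // u; rewrite D2 (d1 _).2 (dd_comp u dF (dc _ _)).
Qed.

End LeviCivita.

(** * Curvature as a multilinear form *)

Section CurvatureTensor.
Context {R : realType} {m : nat}.
Variables (U : set 'rV[R]_m) (G : 'rV[R]_m -> 'M[R]_m).
Variable rG : riemannian_on U G.

Lemma dd_lincomb (V W : normedModType R) (f g : V -> W) a u y :
  differentiable f y -> differentiable g y ->
  dd u (fun z => a *: f z + g z) y = a *: dd u f y + dd u g y.
Proof.
move=> df dg; rewrite !ddE deriveD; first by rewrite deriveZ//; exact: diff_derivable.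
  by apply: derivableZ; exact: diff_derivable.
exact: diff_derivable.
Qed.

Let combine n a (A A' B B' C C' D D' : 'rV[R]_n) :
  a *: A + A' - (a *: B + B') + (a *: C + C') - (a *: D + D') =
  a *: (A - B + C - D) + (A' - B' + C' - D').
Proof. by apply/rowP => i; rewrite !mxE; ring. Qed.

Lemma curvE y u v w :
  curv G y u v w =
  dd u (fun z => chr G z v w) y - dd v (fun z => chr G z u w) y
  + chr G y u (chr G y v w) - chr G y v (chr G y u w).
Proof.
rewrite unlock /riemann /nabla.
(* The covariant derivative of a constant field is its Christoffel term alone. *)
have E a : (fun z => 'D_a (cst w) z + christoffel G z a (cst w z)) = fun z =>
  chr G z a w.
  by apply/funext => z; rewrite derive_cst add0r chrE.
rewrite !derive_cst !E -!ddE !add0r !chrE.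
by rewrite opprD !addrA; congr (_ - _); rewrite addrAC.
Qed.

Lemma curv_antisym y u v w : curv G y u v w = - curv G y v u w.
Proof. by rewrite unlock /riemann opprB. Qed.

Lemma curv_linear_fst y v w : U y -> linear (fun u => curv G y u v w).
Proof.
move=> Uy a u u' /=; rewrite !curvE.
have [oU _ _] := rG.
have e1 := dd_linear (differentiable_chr rG v w Uy) a u u'.
have e2 : dd v (fun z => chr G z (a *: u + u') w) y =
  a *: dd v (fun z => chr G z u w) y + dd v (fun z => chr G z u' w) y.
  rewrite -(dd_lincomb a v (differentiable_chr rG u w Uy) (differentiable_chr rG u' w
    Uy)).
  by apply: dd_eq_on oU Uy _ => z Uz; exact: (chr_linl rG w Uz).
have e3 := chr_linl rG (chr G y v w) Uy a u u'.
have e4 : chr G y v (chr G y (a *: u + u') w) =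
    a *: chr G y v (chr G y u w) + chr G y v (chr G y u' w).
  have e := chr_linl rG w Uy a u u'; rewrite /= in e; rewrite e.
  exact: (chr_linr rG v Uy).
rewrite /= in e1 e3; rewrite e1 e2 e3 e4; exact: combine.
Qed.

Lemma curv_linear_thd y u v : U y -> linear (curv G y u v).
Proof.
move=> Uy a w w'; rewrite !curvE.
have [oU _ _] := rG.
have e1 u1 : dd u1 (fun z => chr G z v (a *: w + w')) y =
  a *: dd u1 (fun z => chr G z v w) y + dd u1 (fun z => chr G z v w') y.
  rewrite -(dd_lincomb a u1 (differentiable_chr rG v w Uy) (differentiable_chr rG v
    w' Uy)).
  by apply: dd_eq_on oU Uy _ => z Uz; exact: (chr_linr rG v Uz).
have e2 u1 : dd u1 (fun z => chr G z u (a *: w + w')) y =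
  a *: dd u1 (fun z => chr G z u w) y + dd u1 (fun z => chr G z u w') y.
  rewrite -(dd_lincomb a u1 (differentiable_chr rG u w Uy) (differentiable_chr rG u
    w' Uy)).
  by apply: dd_eq_on oU Uy _ => z Uz; exact: (chr_linr rG u Uz).
have e3 u1 v1 : chr G y u1 (chr G y v1 (a *: w + w')) =
    a *: chr G y u1 (chr G y v1 w) + chr G y u1 (chr G y v1 w').
  have e := chr_linr rG v1 Uy a w w'; rewrite e.
  exact: (chr_linr rG u1 Uy).
rewrite e1 e2 !e3; exact: combine.
Qed.

Lemma curv_quadrilinear y : U y ->
  quadrilinear (fun a b c d => ip (G y) (curv G y a b c) d).
Proof.
move=> Uy; split=> [b c d k u v|a c d k u v|a b d k u v|a b c] /=.
- by have /= -> := curv_linear_fst b c Uy k u v; exact: ip_linl.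
- have /= e := curv_linear_fst a c Uy k u v.
  (* The second slot is reduced to the first by antisymmetry. *)
  rewrite curv_antisym e opprD -scalerN -!curv_antisym; exact: ip_linl.
- by have /= -> := curv_linear_thd a b Uy k u v; exact: ip_linl.
- exact: ip_linr.
Qed.

End CurvatureTensor.

(** * Connection pulled back along an isometric map *)

Section GaussEquation.
Context {R : realType} {m p : nat}.
Variables (U : set 'rV[R]_m) (G : 'rV[R]_m -> 'M[R]_m).
Variables (Ub : set 'rV[R]_p) (Gb : 'rV[R]_p -> 'M[R]_p).
Variable F : 'rV[R]_m -> 'rV[R]_p.
Variable (rG : riemannian_on U G) (rGb : riemannian_on Ub Gb).
Variable (sF : smooth_on U F) (UF : forall y, U y -> Ub (F y)).
Hypothesis isoF : forall y, U y -> forall u v,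
  ip (Gb (F y)) (dd u F y) (dd v F y) = ip (G y) u v.

Let oU : open U. Proof. by case: rG. Qed.
Let dF y : U y -> differentiable F y.
Proof. exact: smooth_on_differentiable. Qed.
Let ddF u y : U y -> differentiable (dd u F) y.
Proof. by move=> Uy; exact: (smooth_on_differentiable (smooth_on_dd u sF)). Qed.
Let dddF u v y : U y -> differentiable (dd v (dd u F)) y.
Proof.
by move=> Uy; exact: (smooth_on_differentiable (smooth_on_dd v (smooth_on_dd u sF))).
Qed.
Let gGb y : U y -> gram_mx (Gb (F y)).
Proof. by move=> /UF; case: rGb => _ _; apply. Qed.
Let dG y : U y -> differentiable G y.
Proof. by case: rG => _ sG _; exact: smooth_on_differentiable. Qed.
Let dGb y : U y -> differentiable Gb (F y).
Proof. by move=> /UF; case: rGb => _ sG _; exact: smooth_on_differentiable. Qed.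

(* Sealed-term counterparts of [nabla_along] and [second_ff_loc]. *)
Definition nab (u : 'rV[R]_m) (W : 'rV[R]_m -> 'rV[R]_p) (y : 'rV[R]_m) :=
  dd u W y + chr Gb (F y) (dd u F y) (W y).

Definition sff (y u v : 'rV[R]_m) := nab u (dd v F) y - dd (chr G y u v) F y.

Lemma dd_swap (W : 'rV[R]_m -> 'rV[R]_p) y u v : smooth_on U W -> U y ->
  dd u (dd v W) y = dd v (dd u W) y.
Proof.
move=> sW Uy; rewrite [LHS]ddE [RHS]ddE.
have E w : dd w W = 'D_w W by apply/funext => z; rewrite ddE.
have dW w : differentiable (dd w W) y.
  by exact: (smooth_on_differentiable (smooth_on_dd w sW)).
move: (dW u) (dW v); rewrite !E => du dv.
by apply: derive_sym oU Uy _ dv du => z; exact: smooth_on_differentiable.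
Qed.

(** By the chain rule [Gb] along [F] varies as [Gb] in the direction [dd u F y]; compatibility in
    the target turns this into the Christoffel parts of the two [nab] terms. *)
Lemma nab_compat (W Z : 'rV[R]_m -> 'rV[R]_p) y u : U y ->
  differentiable W y -> differentiable Z y ->
  dd u (fun z => ip (Gb (F z)) (W z) (Z z)) y =
  ip (Gb (F y)) (nab u W y) (Z y) + ip (Gb (F y)) (W y) (nab u Z y).
Proof.
move=> Uy dW dZ.
have dGF : differentiable (fun z => Gb (F z)) y.
  exact: (differentiable_comp (dF Uy) (dGb Uy)).
have [_ ->] := dd_ip dGF dW dZ.
rewrite (dd_comp u (dF Uy) (dGb Uy)) (chr_compat rGb _ _ _ (UF Uy)).
by rewrite /nab ipDl ipDr; ring.
Qed.

Lemma nab_torsion_free y u v : U y -> nab u (dd v F) y = nab v (dd u F) y.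
Proof. by move=> Uy; rewrite /nab dd_swap// (chrC rGb _ _ (UF Uy)). Qed.

(** The Koszul argument again: differentiating the isometry identity writes the derivatives of [G]
    through [nab], and torsion-freeness cancels everything in the Koszul form except two equal
    terms. *)
Lemma nab_tangent y u v w : U y ->
  ip (Gb (F y)) (nab u (dd v F) y) (dd w F y) = ip (G y) (chr G y u v) w.
Proof.
move=> Uy; have n2 : (2 : R) != 0 by rewrite pnatr_eq0.
have g a b c : ip (dd a G y) b c =
    ip (Gb (F y)) (nab a (dd b F) y) (dd c F y)
    + ip (Gb (F y)) (nab a (dd c F) y) (dd b F y).
  rewrite -(dd_ip_cst b c (dG Uy)).2 (ipC (nab a (dd c F) y) _ (gGb Uy).1).
  rewrite -(nab_compat a Uy (ddF b Uy) (ddF c Uy)).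
  by apply: dd_eq_on oU Uy _ => z Uz; rewrite isoF.
apply: (mulfI n2); rewrite (koszul rG u v w Uy) /koszul_form !g.
rewrite (nab_torsion_free v u Uy) (nab_torsion_free w u Uy) (nab_torsion_free w v Uy).
ring.
Qed.

Lemma sff_normal y u v w : U y -> ip (Gb (F y)) (sff y u v) (dd w F y) = 0.
Proof. by move=> Uy; rewrite /sff ipBl nab_tangent// isoF// subrr. Qed.

Lemma sffC y u v : U y -> sff y u v = sff y v u.
Proof. by move=> Uy; rewrite /sff nab_torsion_free// (chrC rG u v Uy). Qed.

Lemma sff_linl y v : U y -> linear (fun u => sff y u v).
Proof.
move=> Uy a u w /=; rewrite /sff /nab.
have e1 := dd_linear (ddF v Uy) a u w.
have e2 := dd_linear (dF Uy) a u w.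
have e3 := chr_linl rGb (dd v F y) (UF Uy) a (dd u F y) (dd w F y).
have e4 := chr_linl rG v Uy a u w.
have e5 := dd_linear (dF Uy) a (chr G y u v) (chr G y w v).
rewrite /= in e1 e2 e3 e4 e5; rewrite e1 e2 e3 e4 e5.
by apply/rowP => i; rewrite !mxE; ring.
Qed.

Lemma sff_linr y u : U y -> linear (sff y u).
Proof.
move=> Uy a v w; rewrite (sffC u _ Uy) (sffC u v Uy) (sffC u w Uy).
exact: (sff_linl u Uy).
Qed.

Lemma differentiable_nab y v w : U y -> differentiable (nab v (dd w F)) y.
Proof.
move=> Uy; apply: differentiableD; first exact: dddF.
exact: (dd_chr_along rGb oU Uy UF (dF Uy) (ddF v Uy) (ddF w Uy)).1.
Qed.

(** Differentiate [nab_tangent] along [u] and move one derivative across the product with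
    [nab_compat]; the correction term then splits orthogonally. *)
Lemma nab_nab_tangent y u v w z : U y ->
  ip (Gb (F y)) (nab u (nab v (dd w F)) y) (dd z F y) =
  ip (G y) (dd u (fun q => chr G q v w) y + chr G y u (chr G y v w)) z
  - ip (Gb (F y)) (sff y v w) (sff y u z).
Proof.
move=> Uy.
have e1 := nab_compat u Uy (differentiable_nab v w Uy) (ddF z Uy).
have e2 : dd u (fun q => ip (Gb (F q)) (nab v (dd w F) q) (dd z F q)) y =
    ip (dd u G y) (chr G y v w) z + ip (G y) (dd u (fun q => chr G q v w) y) z.
  rewrite (dd_eq_on u oU Uy (fun q Uq => nab_tangent v w z Uq)).
  have [_ ->] := dd_ip (dG Uy) (differentiable_chr rG v w Uy) (differentiable_cst z y).
  by rewrite dd_cst ip0r addr0.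
(* Both fields split into a normal part [sff] and a tangent part, and the mixed products vanish. *)
have e3 : ip (Gb (F y)) (nab v (dd w F) y) (nab u (dd z F) y) =
    ip (Gb (F y)) (sff y v w) (sff y u z) + ip (G y) (chr G y v w) (chr G y u z).
  have s a b : nab a (dd b F) y = sff y a b + dd (chr G y a b) F y by rewrite subrK.
  rewrite !s -(isoF Uy); have [sGb _] := gGb Uy.
  move: (sff_normal v w (chr G y u z) Uy) (sff_normal u z (chr G y v w) Uy).
  move: (sff y v w) (sff y u z) (dd (chr G y v w) F y) (dd (chr G y u z) F y) =>
    a b c d ad bc.
  by rewrite !ipDl !ipDr ad (ipC c b sGb) bc addr0 add0r.
rewrite e2 e3 (chr_compat rG u _ _ Uy) in e1.
rewrite (ipDl (G y)); move/eqP: e1; rewrite -subr_eq => /eqP <-; ring.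
Qed.

(** In the commutator all terms containing second or third derivatives of [F] are symmetric in [u]
    and [v], so only the curvature of the target survives. *)
Lemma nab_curvature y u v w : U y ->
  nab u (nab v (dd w F)) y - nab v (nab u (dd w F)) y =
  curv Gb (F y) (dd u F y) (dd v F y) (dd w F y).
Proof.
move=> Uy; rewrite curvE.
have e a b : nab a (nab b (dd w F)) y =
  dd a (dd b (dd w F)) y
  + (dd (dd a F y) (fun q => chr Gb q (dd b F y) (dd w F y)) (F y)
     + chr Gb (F y) (dd a (dd b F) y) (dd w F y)
     + chr Gb (F y) (dd b F y) (dd a (dd w F) y))
  + (chr Gb (F y) (dd a F y) (dd b (dd w F) y)
     + chr Gb (F y) (dd a F y) (chr Gb (F y) (dd b F y) (dd w F y))).
  have [dc dcE] := dd_chr_along rGb oU Uy UF (dF Uy) (ddF b Uy) (ddF w Uy).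
  rewrite [LHS]/nab; congr (_ + _).
    rewrite -dcE -[dd a (dd b (dd w F)) y]scale1r -dd_lincomb//; last exact: dddF.
    by congr (dd a _ y); apply/funext => q; rewrite scale1r.
  have := chr_linr rGb (dd a F y) (UF Uy) 1 (dd b (dd w F) y).
  by move=> /(_ (chr Gb (F y) (dd b F y) (dd w F y))); rewrite !scale1r.
rewrite !e (dd_swap u v (smooth_on_dd w sF) Uy) (dd_swap u v sF Uy).
by apply/rowP => i; rewrite !mxE; ring.
Qed.

(** Antisymmetrization of [nab_nab_tangent] in [u] and [v], the tangential parts combining into the
    curvature of [G]. *)
Lemma gauss_equation y u v w z : U y ->
  ip (Gb (F y)) (curv Gb (F y) (dd u F y) (dd v F y) (dd w F y)) (dd z F y) =
  ip (G y) (curv G y u v w) z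
  - ip (Gb (F y)) (sff y v w) (sff y u z) + ip (Gb (F y)) (sff y u w) (sff y v z).
Proof.
move=> Uy; rewrite -nab_curvature// ipBl !nab_nab_tangent// curvE.
by rewrite !(ipDl (G y), ipNl (G y)); ring.
Qed.

End GaussEquation.

(** * Orthonormal frames *)

Section Orthonormal.
Context {R : realType} {m : nat}.
Variable A : 'M[R]_m.
Hypothesis gA : gram_mx A.
Implicit Types (V : {vspace 'rV[R]_m}) (e : seq 'rV[R]_m).

Definition orthonormal_seq e := forall a b, (a < size e)%N -> (b < size e)%N ->
  ip A e`_a e`_b = (a == b)%:R.

Lemma orthonormal_seq_coef e (c : nat -> R) a : orthonormal_seq e -> (a < size e)%N ->
  ip A (\sum_(b < size e) c b *: e`_b) e`_a = c a.
Proof.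
move=> oe ae; rewrite ip_suml (bigD1 (Ordinal ae)) //= big1 => [|b ba].
  by rewrite addr0 ipZl oe// eqxx mulr1.
rewrite ipZl oe//.
by move: ba; rewrite -val_eqE /= => /negbTE ->; rewrite mulr0.
Qed.

Lemma orthonormal_seq_free e : orthonormal_seq e -> free e.
Proof.
move=> oe; rewrite (_ : e = in_tuple e)//; apply/freeP => k k0 i.
(* Coefficients are functions on [nat]; outside the index range they take the irrelevant value 0. *)
have /= := @orthonormal_seq_coef e (fun b => if insub b is Some j then k j else 0) i
  oe (ltn_ord i).
rewrite valK => <-.
rewrite (_ : \sum_(b < size e) _ = 0) ?ip0l//.
by rewrite -[RHS]k0; apply: eq_bigr => b _; rewrite valK.
Qed.

Lemma orthonormal_seq_expand e v : orthonormal_seq e -> v \in <<e>>%VS ->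
  v = \sum_(b < size e) ip A v e`_b *: e`_b.
Proof.
move=> oe; rewrite -[e in <<e>>%VS]/(tval (in_tuple e)) => /coord_span E.
rewrite [LHS]E; apply: eq_bigr => b _ /=; congr (_ *: _); rewrite [in RHS]E.
have := @orthonormal_seq_coef e (fun b => if insub b is Some j then coord (in_tuple
  e) j v else 0) b oe (ltn_ord b).
rewrite valK => <-; congr (ip A _ _); apply: eq_bigr => j _; by rewrite valK.
Qed.

Lemma gram_schmidt V : exists e, orthonormal_basis A V e.
Proof.
suff H (X : seq 'rV[R]_m) : free X -> exists e, [/\ orthonormal_seq e,
  size e = size X & <<e>>%VS = <<X>>%VS].
  have [e [oe se spe]] := H _ (basis_free (vbasisP V)).
  exists e; split=> //; rewrite basisEfree orthonormal_seq_free//= spe se.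
  by rewrite (span_basis (vbasisP V)) size_tuple subvv leqnn.
elim: X => [_|x X IH]; first by exists [::]; split.
rewrite free_cons => /andP[xX /IH [e [oe se spe]]].
pose y := x - \sum_(b < size e) ip A x e`_b *: e`_b.
have ye a : (a < size e)%N -> ip A y e`_a = 0.
  by move=> ae; rewrite ipBl (orthonormal_seq_coef (fun b => ip A x e`_b))// subrr.
have sume : \sum_(b < size e) ip A x e`_b *: e`_b \in <<X>>%VS.
  by rewrite -spe; apply: memv_suml => b _; apply: memvZ; apply: memv_span;
    exact: mem_nth.
(* A zero remainder would put [x] in the span of [X], against freeness. *)
have y0 : y != 0.
  by apply: contra xX; rewrite subr_eq0 => /eqP ->.
have yy : 0 < ip A y y by case: gA => _; apply.
pose z := (Num.sqrt (ip A y y))^-1 *: y.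
have sq0 : Num.sqrt (ip A y y) != 0 by rewrite gt_eqF// sqrtr_gt0.
have zz : ip A z z = 1.
  rewrite ipZl ipZr -[X in _ * (_ * X)](sqr_sqrtr (ltW yy)) expr2.
  by rewrite mulKf// mulVf.
have ze a : (a < size e)%N -> ip A z e`_a = 0 by move=> ae; rewrite ipZl ye// mulr0.
exists (z :: e); split; last 2 first.
- by rewrite /= se.
- apply/eqP; rewrite !span_cons spe eqEsubv !subv_add !addvSr !andbT -!memvE.
  apply/andP; split.
    by rewrite memvZ// memvB//; [apply: (subvP (addvSl _ _));
      exact: memv_line|exact: (subvP (addvSr _ _))].
  have -> : x = Num.sqrt (ip A y y) *: z + \sum_(b < size e) ip A x e`_b *: e`_b.
    by rewrite scalerA mulfV// scale1r subrK.
  by apply: memv_add sume; apply: memvZ; exact: memv_line.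
move=> [|a] [|b] //= ae be; first by rewrite ze.
  by rewrite (ipC _ _ gA.1) ze.
exact: oe.
Qed.

(** Existence ensures that the default [[::]] in [onb] is never the value by failure. *)
Lemma onbP V : orthonormal_basis A V (onb A V).
Proof. exact: xgetPex (gram_schmidt V). Qed.

Lemma size_onb V e : orthonormal_basis A V e -> size e = \dim V.
Proof. by move=> [be _]; rewrite -(span_basis be) (eqP (basis_free be)). Qed.

(** Expanding one basis in the other turns both traces into the same double sum of
    [ip A e_i e'_j *: b e_i e'_j]. *)
Lemma trace_indep (W : lmodType R) (b : 'rV[R]_m -> 'rV[R]_m -> W) V e e' :
  (forall u, linear (b u)) -> (forall v, linear (fun u => b u v)) ->
  orthonormal_basis A V e -> orthonormal_basis A V e' ->
  \sum_(u <- e) b u u = \sum_(u <- e') b u u.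
Proof.
move=> br bl [be oe] [be' oe'].
have sp := span_basis be; have sp' := span_basis be'.
have mem a : (a < size e)%N -> e`_a \in <<e'>>%VS.
  by move=> ae; rewrite sp' -sp; apply: memv_span; exact: mem_nth.
have mem' a : (a < size e')%N -> e'`_a \in <<e>>%VS.
  by move=> ae; rewrite sp -sp'; apply: memv_span; exact: mem_nth.
rewrite [LHS](big_nth 0) [RHS](big_nth 0) !big_mkord.
transitivity (\sum_(i < size e) \sum_(j < size e') ip A e`_i e'`_j *: b e`_i e'`_j).
  by apply: eq_bigr => i _; rewrite -(linear_comb _ _ _ (br _))
    -(orthonormal_seq_expand oe' (mem i _)).
rewrite exchange_big; apply: eq_bigr => j _ /=.
rewrite [RHS](_ : _ = b (\sum_(i < size e) ip A e'`_j e`_i *: e`_i) e'`_j).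
  rewrite (linear_comb _ _ _ (bl _)); apply: eq_bigr => i _.
  by rewrite (ipC _ _ gA.1).
by rewrite -(orthonormal_seq_expand oe (mem' j _)).
Qed.

End Orthonormal.

(** * Maxima over orthonormal frames *)

Section FrameMaximum.
Context {R : realType} {m : nat}.
Variable A : 'M[R]_m.
Hypothesis gA : gram_mx A.

(** Any finite index type is allowed, to cover both frames of one subspace and frames adapted to a
    family. *)
Definition frame (W : {vspace 'rV[R]_m}) (T : finType) (e : T -> 'rV[R]_m) :=
  (forall t, e t \in W) /\ forall t t', ip A (e t) (e t') = (t == t')%:R.

Lemma quadrilinear_differentiable (Q : 'rV[R]_m -> 'rV[R]_m -> 'rV[R]_m ->
  'rV[R]_m -> R)
    (V : normedModType R) (X1 X2 X3 X4 : V -> 'rV[R]_m) y :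
  quadrilinear Q ->
  differentiable X1 y -> differentiable X2 y -> differentiable X3 y ->
  differentiable X4 y ->
  differentiable (fun z => Q (X1 z) (X2 z) (X3 z) (X4 z)) y.
Proof.
move=> [l1 l2 l3 l4] d1 d2 d3 d4.
have D1 b c d := (derive_lin openT (I : setT y) (fun z _ => l1 b c d)
  (fun w => differentiable_cst _ y) d1).1.
have D2 c d := (derive_lin openT (I : setT y) (fun z _ => l2 (X1 z) c d) (fun b =>
  D1 b c d) d2).1.
have D3 d := (derive_lin openT (I : setT y) (fun z _ => l3 (X1 z) (X2 z) d) (fun c =>
  D2 c d) d3).1.
exact: (derive_lin openT (I : setT y) (fun z _ => l4 (X1 z) (X2 z) (X3 z)) D3 d4).1.
Qed.

Variables (W : {vspace 'rV[R]_m}) (T : finType).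
Hypothesis cardT : (#|T| <= \dim W)%N.

(** The relation [P] lets one compactness argument serve twice: with pairs in increasing blocks for
    mutual curvature, and with all pairs for the squared norm of a trace. *)
Lemma frame_max (Q : 'rV[R]_m -> 'rV[R]_m -> 'rV[R]_m -> 'rV[R]_m -> R) (P : rel T) :
  quadrilinear Q ->
  exists e : T -> 'rV[R]_m, frame W e /\
    forall e', frame W e' ->
      \sum_t \sum_(t' | P t t') Q (e' t) (e' t') (e' t') (e' t) <=
      \sum_t \sum_(t' | P t t') Q (e t) (e t') (e t') (e t).
Proof.
move=> lQ; pose B := onb A W.
have [bB oB] : orthonormal_basis A W B := onbP gA W.
have sB : size B = \dim W by apply: (size_onb (conj bB oB)).
(* A frame is encoded by its coefficients in an orthonormal basis of [W], flattened to one row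
   vector so that closed bounded sets are compact. *)
pose J := (T * 'I_(\dim W))%type.
pose ent (c : 'rV[R]_#|{: J}|) (t : T) (b : 'I_(\dim W)) : R := c 0 (enum_rank (t, b)).
pose E c t := \sum_(b < \dim W) ent c t b *: B`_b.
have ipE c t t' : ip A (E c t) (E c t') = \sum_b ent c t b * ent c t' b.
  rewrite ip_suml; apply: eq_bigr => b _; rewrite ipZl; congr (_ * _).
  rewrite ip_sumr (bigD1 b)//= big1 => [|b' bb'].
    by rewrite addr0 ipZr oB ?sB// eqxx mulr1.
  by rewrite ipZr oB ?sB// eq_sym -val_eqE /= in bb' *; rewrite (negbTE bb') mulr0.
have EW c t : E c t \in W.
  apply: memv_suml => b _; apply: memvZ.
  by apply: (basis_mem bB); apply: mem_nth; rewrite sB.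
pose S := [set c | forall t t', \sum_b ent c t b * ent c t' b = (t == t')%:R].
have SE c : S c -> frame W (E c).
  by move=> Sc; split=> // t t'; rewrite ipE Sc.
have dent t b c : differentiable (fun c => ent c t b) c.
  exact: differentiable_coord.
have cS : compact S.
  apply: bounded_closed_compact.
    exists 1; split=> // M M1 c Sc; apply: le_trans (ltW M1).
    rewrite [leLHS]/Num.Def.normr /= mx_normrE; apply: bigmax_le => // -[i j] _ /=.
    rewrite ord1 -(enum_valK j); case: (enum_val j) => t b; rewrite -/(ent c t b).
    (* The squared coefficients of a unit vector sum to 1, so each is at most 1. *)
    have := Sc t t; rewrite eqxx mulr1n (bigD1 b)//= => e1.
    have : ent c t b ^+ 2 <= 1.
      rewrite -e1 -expr2 lerDl sumr_ge0// => b' _; rewrite -expr2; exact: sqr_ge0.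
    by rewrite -(real_normK (num_real _)) expr_le1.
  rewrite (_ : S = \bigcap_(q in [set: T * T])
    ((fun c => \sum_b ent c q.1 b * ent c q.2 b) @^-1` [set r | r =
      (q.1 == q.2)%:R])); last first.
    by apply/seteqP; split=> [c Sc [t t'] _ /=|c Hc t t'];
      [exact: Sc|exact: (Hc (t, t') I)].
  apply: closed_bigI => -[t t'] _ /=.
  apply: (continuous_closedP _).1; last exact: closed_eq.
  move=> c; apply: differentiable_continuous.
  apply: (differentiable_bigsum _ _).1 => b.
  exact: differentiableM.
have S0 : S !=set0.
  (* An explicit frame: distinct indices are sent to distinct basis vectors, which [cardT]
     permits. *)
  pose f (t : T) : 'I_(\dim W) := widen_ord cardT (enum_rank t).
  exists (\row_j (let q := enum_val j in (q.2 == f q.1)%:R)) => t t'.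
  rewrite (bigD1 (f t))//= big1 => [|b bt].
    rewrite addr0 /ent !mxE !enum_rankK /= eqxx mul1r.
    by rewrite -val_eqE /= (inj_eq val_inj) (inj_eq enum_rank_inj).
  by rewrite /ent !mxE !enum_rankK /= (negbTE bt) mul0r.
pose Phi (e : T -> 'rV[R]_m) := \sum_t \sum_(t' | P t t') Q (e t) (e t') (e t') (e t).
have cPhi : {within S, continuous (fun c => Phi (E c))}.
  apply: continuous_subspaceT => c; apply: differentiable_continuous.
  apply: (differentiable_bigsum _ _).1 => t.
  under eq_fun do rewrite big_mkcond.
  apply: (differentiable_bigsum _ _).1 => t'.
  case: (P t t'); last exact: differentiable_cst.
  have dE s : differentiable (fun c => E c s) c.
    by apply: (differentiable_bigsum _ _).1 => b; exact: differentiableZl.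
  exact: quadrilinear_differentiable.
have [c + cmax] := compact_EVT_max S0 cS cPhi.
rewrite inE => Sc; exists (E c); split; first exact: SE.
move=> e' [e'W oe'].
pose c' : 'rV[R]_#|{: J}| := \row_j (let q : J := enum_val j in ip A (e' q.1) B`_q.2).
have Ec' : E c' = e'.
  apply/funext => t; rewrite [RHS](orthonormal_seq_expand oB);
    last by rewrite (span_basis bB).
  rewrite sB; apply: eq_bigr => b _; congr (_ *: _).
  by rewrite /ent mxE enum_rankK.
rewrite -[X in X <= _]/(Phi e') -Ec'; apply: cmax; rewrite inE => t t'.
by rewrite -ipE Ec' oe'.
Qed.

End FrameMaximum.

(** * Orthogonal families as block frames *)

Section OrthogonalFamilies.
Context {R : realType} {m : nat}.
Variable A : 'M[R]_m.
Hypothesis gA : gram_mx A.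
Implicit Types (Q : 'rV[R]_m -> 'rV[R]_m -> 'rV[R]_m -> 'rV[R]_m -> R).
Implicit Types (W : {vspace 'rV[R]_m}).

Lemma trace_indep2 Q V1 V2 e1 e1' e2 e2' : quadrilinear Q ->
  orthonormal_basis A V1 e1 -> orthonormal_basis A V1 e1' ->
  orthonormal_basis A V2 e2 -> orthonormal_basis A V2 e2' ->
  \sum_(u <- e1) \sum_(v <- e2) Q u v v u = \sum_(u <- e1') \sum_(v <- e2') Q u v v u.
Proof.
move=> [l1 l2 l3 l4] o1 o1' o2 o2'.
transitivity (\sum_(u <- e1) \sum_(v <- e2') Q u v v u).
  apply: eq_bigr => u _.
  exact: (trace_indep gA (fun v => l3 u v u) (fun v => l2 u v u) o2 o2').
rewrite exchange_big [RHS]exchange_big; apply: eq_bigr => v _ /=.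
exact: (trace_indep gA (fun u => l4 u v v) (fun u => l1 v v u) o1 o1').
Qed.

Variables (k : nat) (n : 'I_k -> nat).

Let T := {a : 'I_k & 'I_(n a)}.

(** With dependent pairs as indices, a family of mutually orthogonal subspaces becomes one
    orthonormal frame, and this is its part in the subspace of index [a]. *)
Definition block (e : T -> 'rV[R]_m) (a : 'I_k) : seq 'rV[R]_m :=
  [seq e (Tagged (fun a => 'I_(n a)) i) | i <- enum 'I_(n a)].

Lemma card_blocks : #|{: T}| = (\sum_a n a)%N.
Proof. by rewrite card_tagged sumnE big_map big_enum; apply: eq_bigr => a _;
  rewrite card_ord. Qed.

Lemma big_block (W : nmodType) (F : 'rV[R]_m -> W) e a :
  \sum_(u <- block e a) F u = \sum_(i < n a) F (e (Tagged (fun a => 'I_(n a)) i)).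
Proof. by rewrite /block big_map big_enum. Qed.

Lemma big_tagged (W : nmodType) (P : pred 'I_k) (F : T -> W) :
  \sum_(t | P (tag t)) F t = \sum_(a | P a) \sum_(i < n a) F (Tagged (fun a =>
    'I_(n a)) i).
Proof.
rewrite (sig_big_dep P (fun=> xpredT) (fun a i => F (Tagged (fun a => 'I_(n a)) i))).
by apply: eq_big => -[a i]; rewrite ?andbT.
Qed.

Lemma size_block e a : size (block e a) = n a.
Proof. by rewrite /block size_map size_enum_ord. Qed.

Lemma nth_block e a i (hi : (i < n a)%N) :
  (block e a)`_i = e (Tagged (fun a => 'I_(n a)) (Ordinal hi)).
Proof.
rewrite /block (nth_map (Ordinal hi)) ?size_enum_ord//.
by congr (e (Tagged _ _)); exact: (nth_ord_enum _ (Ordinal hi)).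
Qed.

(** The shape of [mutual_curvature] once sectional denominators are 1; a general [Q] serves source
    and target alike. *)
Definition mutual_sum Q (V : 'I_k -> {vspace 'rV[R]_m}) :=
  \sum_(a < k) \sum_(b < k | (a < b)%N)
    \sum_(u <- onb A (V a)) \sum_(v <- onb A (V b)) Q u v v u.

(** Trades the arbitrary bases [onb] for the blocks of one frame, which gives the expression that
    [frame_max] maximizes. *)
Lemma mutual_sumE Q V e : quadrilinear Q ->
  (forall a, orthonormal_basis A (V a) (block e a)) ->
  mutual_sum Q V =
  \sum_(t : T) \sum_(t' : T | (tag t < tag t')%N) Q (e t) (e t') (e t') (e t).
Proof.
move=> lQ oV; rewrite (big_tagged xpredT); apply: eq_bigr => a _.
under [RHS]eq_bigr do rewrite (big_tagged (fun b : 'I_k => (a < b)%N)).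
rewrite [RHS]exchange_big; apply: eq_bigr => b _ /=.
rewrite (trace_indep2 lQ (onbP gA (V a)) (oV a) (onbP gA (V b)) (oV b)).
by rewrite big_block; apply: eq_bigr => i _; rewrite big_block.
Qed.

(** With its converse [family_frame], this turns maximization over families into maximization over
    frames. *)
Lemma frame_family W e : frame A W e ->
  exists V, orth_family A W n V /\ forall a, orthonormal_basis A (V a) (block e a).
Proof.
move=> [eW oe]; exists (fun a => <<block e a>>%VS).
have on a : orthonormal_seq A (block e a).
  rewrite /orthonormal_seq size_block => i j hi hj.
  by rewrite !nth_block oe -tag_eqE /tag_eq /= eqxx /= tagged_asE.
have ob a : orthonormal_basis A <<block e a>> (block e a).
  by split; [rewrite /basis_of eqxx (orthonormal_seq_free (on a))|exact: on].
split=> //; split=> [a|a|a b ab u v].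
- by apply/span_subvP => u /mapP[i _ ->].
- by rewrite -(size_onb (ob a)) size_block.
move=> /(orthonormal_seq_expand (on a)) -> /(orthonormal_seq_expand (on b)) ->.
rewrite ip_suml big1// => i _; rewrite ip_sumr big1// => j _.
rewrite ipZl ipZr; case: i j => [i /= +] [j /= +].
rewrite !size_block => hi hj.
by rewrite !nth_block oe -tag_eqE /tag_eq /= (negbTE ab) !mulr0.
Qed.

Lemma family_frame W V : orth_family A W n V ->
  exists e, frame A W e /\ forall a, orthonormal_basis A (V a) (block e a).
Proof.
move=> [VW dV oV].
have sz a : size (onb A (V a)) = n a by rewrite (size_onb (onbP gA _)).
pose e (t : T) := (onb A (V (tag t)))`_(tagged t).
have eV t : e t \in V (tag t).
  by apply: (basis_mem (onbP gA _).1); apply: mem_nth; rewrite sz.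
exists e; split; first split.
- by move=> t; apply: (subvP (VW _)) (eV t).
- move=> [a i] [b j]; have [ab|ab] := eqVneq a b; last first.
    rewrite (oV a b ab _ _ (eV (Tagged (fun a => 'I_(n a)) i)) (eV (Tagged (fun a =>
      'I_(n a)) j))).
    by rewrite -tag_eqE /tag_eq /= (negbTE ab).
  move: j; rewrite -ab => j; rewrite /e /= (onbP gA _).2 ?sz//.
  by rewrite -tag_eqE /tag_eq /= eqxx /= tagged_asE.
move=> a; rewrite (_ : block e a = onb A (V a)); first exact: onbP.
apply: (@eq_from_nth _ 0) => [|i]; rewrite size_block ?sz// => hi.
by rewrite nth_block.
Qed.

(** Gives both the dimension of the sum and the additivity of the trace of h over the summands. *)
Lemma family_sum_basis W V e : frame A W e ->
  (forall a, orthonormal_basis A (V a) (block e a)) ->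
  orthonormal_basis A (\sum_a V a)%VS [seq e t | t <- enum {: T}].
Proof.
move=> [eW oe] ob.
have on : orthonormal_seq A [seq e t | t <- enum {: T}].
  move=> i j; rewrite size_map => hi hj.
  have [t0 _] : exists t0, t0 \in enum {: T} by exists (nth (tnth (in_tuple (enum {:
    T})) (Ordinal hi)) (enum {: T}) i); exact: mem_nth.
  rewrite [X in ip _ X _](nth_map t0)// [X in ip _ _ X](nth_map t0)// oe.
  by rewrite nth_uniq//; exact: enum_uniq.
split=> //; rewrite /basis_of (orthonormal_seq_free on) andbT eqEsubv; apply/andP;
  split.
  apply/span_subvP => u /mapP[[a i] _ ->].
  have aS : (V a <= \sum_a V a)%VS by apply: (sumv_sup a).
  apply: (subvP aS).
  by apply: (basis_mem (ob a).1); apply/mapP; exists i; rewrite ?mem_enum.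
apply/subv_sumP => a _; rewrite -(span_basis (ob a).1).
apply/span_subvP => u /mapP[i _ ->]; apply: memv_span.
by apply/mapP; exists (Tagged (fun a => 'I_(n a)) i); rewrite ?mem_enum.
Qed.

End OrthogonalFamilies.

(** * The pointwise inequality *)

Lemma sum_ord_lt (R : comNzRingType) k (x : 'I_k -> 'I_k -> R) :
  (forall a b, x a b = x b a) ->
  \sum_a \sum_b x a b = 2 * (\sum_(a < k) \sum_(b < k | (a < b)%N) x a b) +
    \sum_a x a a.
Proof.
move=> xC; rewrite mulr2n mulrDl mul1r.
have E : \sum_(a < k) \sum_(b < k | (b < a)%N) x a b =
  \sum_(a < k) \sum_(b < k | (a < b)%N) x a b.
  rewrite [LHS](exchange_big_dep xpredT)//=; apply: eq_bigr => a _.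
  by apply: eq_bigr => b _; exact: xC.
rewrite -[X in X + _ + _]E -!big_split; apply: eq_bigr => a _ /=.
rewrite (bigID (fun b : 'I_k => (b < a)%N)) /= -addrA; congr (_ + _).
rewrite addrC (bigD1 a) ?ltnn//=; congr (_ + _); apply: eq_bigl => b.
by rewrite -leqNgt ltn_neqAle eq_sym andbC.
Qed.

(** With X the sum of the |t_a|^2 and Y the left-hand side, the squared norm of the total is 2Y + X
    and the double sum of squared differences is 2kX - 2(2Y + X). Eliminating X produces both
    constants. *)
Lemma sum_pairs_ip (R : realType) p (A : 'M[R]_p) k (t : 'I_k -> 'rV[R]_p) :
  A^T = A -> (0 < k)%N ->
  \sum_(a < k) \sum_(b < k | (a < b)%N) ip A (t a) (t b) =
  (k%:R - 1) / (2 * k%:R) * ip A (\sum_a t a) (\sum_a t a)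
  - (4 * k%:R)^-1 * \sum_a \sum_b ip A (t a - t b) (t a - t b).
Proof.
move=> sA k0; pose x a b := ip A (t a) (t b).
have xC a b : x a b = x b a by exact: ipC.
have kn0 : k%:R != 0 :> R by rewrite pnatr_eq0 -lt0n.
have -> : ip A (\sum_a t a) (\sum_a t a) = \sum_a \sum_b x a b.
  by rewrite ip_suml; apply: eq_bigr => a _; rewrite ip_sumr.
have -> : \sum_a \sum_b ip A (t a - t b) (t a - t b) =
    2 * k%:R * (\sum_a x a a) - 2 * \sum_a \sum_b x a b.
  transitivity (\sum_a \sum_b ((x a a + x b b) - 2 * x a b)).
    apply: eq_bigr => a _; apply: eq_bigr => b _.
    rewrite ipBl !ipBr -/(x a a) -/(x a b) -/(x b a) -/(x b b) (xC b a); ring.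
  transitivity (\sum_a (k%:R * x a a + \sum_b x b b - 2 * \sum_b x a b)).
    apply: eq_bigr => a _; rewrite sumrB big_split /= sumr_const card_ord.
    by rewrite -mulr_sumr [k%:R * _]mulr_natl.
  rewrite sumrB big_split /= sumr_const card_ord -!mulr_sumr -[_ *+ k]mulr_natl.
  by ring.
rewrite (sum_ord_lt xC); move: (\sum_a x a a) (\sum_a _) => X Y.
by field.
Qed.

Section Pointwise.
Context {R : realType} {m p : nat}.
Variables (A : 'M[R]_m) (Ab : 'M[R]_p).
Hypotheses (gA : gram_mx A) (gAb : gram_mx Ab).
Variable df : {linear 'rV[R]_m -> 'rV[R]_p}.
Hypothesis iso : forall u v, ip Ab (df u) (df v) = ip A u v.
Variables (W : {vspace 'rV[R]_m}) (Wb : {vspace 'rV[R]_p}).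
Hypothesis dfW : forall u, u \in W -> df u \in Wb.
Variable Q : 'rV[R]_m -> 'rV[R]_m -> 'rV[R]_m -> 'rV[R]_m -> R.
Variable Qb : 'rV[R]_p -> 'rV[R]_p -> 'rV[R]_p -> 'rV[R]_p -> R.
Hypotheses (lQ : quadrilinear Q) (lQb : quadrilinear Qb).
Variable h : 'rV[R]_m -> 'rV[R]_m -> 'rV[R]_p.
Hypothesis hr : forall u, linear (h u).
Hypothesis hC : forall u v, h u v = h v u.
Hypothesis gauss : forall u v, Q u v v u =
  Qb (df u) (df v) (df v) (df u) + ip Ab (h u u) (h v v) - ip Ab (h u v) (h u v).

Let hl v : linear (h ^~ v).
Proof. by move=> a u w; rewrite !(hC _ v) hr. Qed.

Definition trace_form V := \sum_(u <- onb A V) h u u.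

Variables (k : nat) (n : 'I_k -> nat).
Let T := {a : 'I_k & 'I_(n a)}.

Lemma orthonormal_basis_image V e : orthonormal_basis A V e ->
  orthonormal_basis Ab (linfun df @: V)%VS (map df e).
Proof.
move=> [be oe].
have os : orthonormal_seq Ab (map df e).
  move=> i j; rewrite size_map => hi hj.
  by rewrite [X in ip _ X _](nth_map 0)// [X in ip _ _ X](nth_map 0)// iso oe.
split=> //; rewrite /basis_of (orthonormal_seq_free os) andbT.
rewrite -(span_basis be) limg_span; apply/eqP; congr (<<_>>%VS).
by apply: eq_map => u; rewrite lfunE.
Qed.

Definition mixed (V : 'I_k -> {vspace 'rV[R]_m}) := forall a b : 'I_k,
  a != b -> forall u v, u \in V a -> v \in V b -> h u v = 0.

(** The defect is kept abstract: what follows uses only its sign and when it vanishes. *)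
Lemma mutual_gauss V : (0 < k)%N -> orth_family A W n V ->
  exists2 D, mutual_sum A Q V =
      mutual_sum Ab Qb (fun a => (linfun df @: V a)%VS)
      + (k%:R - 1) / (2 * k%:R) * ip Ab (trace_form (\sum_a V a)%VS) (trace_form
        (\sum_a V a)%VS)
      - D
    & 0 <= D /\
      (D = 0 <-> mixed V /\ forall a b, trace_form (V a) = trace_form (V b)).
Proof.
move=> k0 oV; have [e [fe oe]] := family_frame gA oV.
have Ha a : trace_form (V a) = \sum_(i < n a) h (e (Tagged (fun a =>
  'I_(n a)) i)) (e (Tagged (fun a => 'I_(n a)) i)).
  by rewrite /trace_form (trace_indep gA hr hl (onbP gA _) (oe a)) big_block.
have HV : trace_form (\sum_a V a)%VS = \sum_(a < k) trace_form (V a).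
  have ob := family_sum_basis fe oe.
  rewrite /trace_form (trace_indep gA hr hl (onbP gA _) ob) big_map big_enum /=.
  rewrite (big_tagged xpredT (fun t => h (e t) (e t))).
  by apply: eq_bigr => a _; rewrite -Ha.
pose tv a := trace_form (V a).
have tE a : trace_form (V a) = tv a by [].
(* [D1] measures how far the partial traces differ, [D2] the size of h on mixed pairs. *)
pose D1 := (4 * k%:R)^-1 * \sum_a \sum_b ip Ab (tv a - tv b) (tv a - tv b).
pose D2 := \sum_(t : T) \sum_(t' : T | (tag t < tag t')%N) ip Ab (h (e t) (e t')) (h
  (e t) (e t')).
have kn0 : k%:R != 0 :> R by rewrite pnatr_eq0 -lt0n.
exists (D1 + D2).
  rewrite (mutual_sumE gA lQ oe).
  have oeb a : orthonormal_basis Ab (linfun df @: V a)%VS (block (df \o e) a).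
    by have := orthonormal_basis_image (oe a); rewrite /block -map_comp.
  rewrite (mutual_sumE gAb lQb oeb).
  have -> : \sum_(t : T) \sum_(t' : T | (tag t < tag t')%N) Q (e t) (e t') (e t') (e
    t) =
     \sum_(t : T) \sum_(t' : T | (tag t < tag t')%N) Qb (df (e t)) (df (e t')) (df (e
       t')) (df (e t))
     + \sum_(t : T) \sum_(t' : T | (tag t < tag t')%N) ip Ab (h (e t) (e t)) (h (e
       t') (e t')) - D2.
    rewrite -big_split -sumrB; apply: eq_bigr => t _.
    by rewrite -big_split -sumrB; apply: eq_bigr => t' _; exact: gauss.
  have -> : \sum_(t : T) \sum_(t' : T | (tag t < tag t')%N) ip Ab (h (e t) (e t)) (h
    (e t') (e t')) =
      \sum_(a < k) \sum_(b < k | (a < b)%N) ip Ab (tv a) (tv b).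
    rewrite (big_tagged xpredT); apply: eq_bigr => a _.
    under eq_bigr do rewrite (big_tagged (fun b : 'I_k => (a < b)%N)).
    rewrite exchange_big; apply: eq_bigr => b _ /=.
    rewrite -!tE !Ha ip_suml; apply: eq_bigr => i _.
    by rewrite ip_sumr.
  by rewrite (sum_pairs_ip tv gAb.1 k0) HV opprD !addrA.
have D10 : 0 <= D1.
  apply: mulr_ge0; first by rewrite invr_ge0 mulr_ge0// ler0n.
  by do 2!(apply: sumr_ge0 => ? _); exact: ip_ge0.
have D20 : 0 <= D2 by do 2!(apply: sumr_ge0 => ? _); exact: ip_ge0.
split; first exact: addr_ge0.
split=> [/eqP|[mV eV]]; last first.
  rewrite /D1 /D2 big1 ?mulr0 ?add0r => [|a _]; last first.
    by rewrite big1// => b _; rewrite (eV a b : tv a = tv b) subrr ip0l.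
  rewrite big1// => t _; rewrite big1// => t' tt'.
  have eVt s : e s \in V (tag s).
    apply: (basis_mem (oe (tag s)).1); apply/mapP; exists (tagged s);
      rewrite ?mem_enum//.
    by case: s.
  rewrite (mV (tag t) (tag t')) ?ip0l//.
  by rewrite neq_ltn tt'.
rewrite paddr_eq0// => /andP[/eqP D1z /eqP D2z]; split; last first.
  move=> a b; apply/eqP; rewrite -subr_eq0; apply/eqP/(ip_eq0 gAb).
  move/eqP: D1z; rewrite mulf_eq0 invr_eq0 mulf_eq0 pnatr_eq0 (negbTE kn0) /=.
  rewrite psumr_eq0 => [/allP/(_ a (mem_index_enum _))/=|a' _];
    last by apply: sumr_ge0 => ? _; exact: ip_ge0.
  rewrite psumr_eq0 => [/allP/(_ b (mem_index_enum _))/eqP//|b' _]; exact: ip_ge0.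
have hz (t t' : T) : (tag t < tag t')%N -> h (e t) (e t') = 0.
  move=> tt'; apply: (ip_eq0 gAb); move/eqP: D2z; rewrite /D2.
  rewrite psumr_eq0 => [/allP/(_ t (mem_index_enum _))/=|s _];
    last by apply: sumr_ge0 => ? _; exact: ip_ge0.
  rewrite psumr_eq0 => [/allP/(_ t' (mem_index_enum _))|s _]; last exact: ip_ge0.
  by rewrite tt' => /eqP.
(* [D2] sees only increasing blocks; symmetry of [h] gives the other order, and bilinearity then
   passes from basis vectors to the subspaces. *)
have hz' (t t' : T) : tag t != tag t' -> h (e t) (e t') = 0.
  by rewrite neq_ltn => /orP[/hz//|/hz]; rewrite hC.
move=> a b ab u v ua vb.
have ex c w : w \in V c -> w = \sum_(i < size (block e c)) ip A w (block e c)`_i *: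
  (block e c)`_i.
  by move=> wc; apply: (orthonormal_seq_expand (oe c).2); rewrite (span_basis (oe c).1).
rewrite (ex a u ua) (linear_comb _ _ _ (hl v)) big1// => i _.
rewrite (ex b v vb) (linear_comb _ _ _ (hr _)) big1 ?scaler0// => j _.
case: i j => [i hi] [j hj] /=; move: (hi) (hj); rewrite !size_block => hi' hj'.
by rewrite !nth_block hz' ?scaler0.
Qed.

End Pointwise.

Lemma sup_max (R : realType) (E : set R) x : E x -> ubound E x -> sup E = x.
Proof.
move=> Ex ub; apply/eqP; rewrite eq_le ge_sup//=; last by exists x.
by apply: ub_le_sup => //; exists x.
Qed.

Lemma mutual_sum_max (R : realType) m (A : 'M[R]_m) W k (n : 'I_k -> nat)
    (Q : 'rV[R]_m -> 'rV[R]_m -> 'rV[R]_m -> 'rV[R]_m -> R) :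
  gram_mx A -> quadrilinear Q -> (\sum_a n a <= \dim W)%N ->
  exists V, orth_family A W n V /\
    sup [set mutual_sum A Q V | V in orth_family A W n] = mutual_sum A Q V /\
    forall V', orth_family A W n V' -> mutual_sum A Q V' <= mutual_sum A Q V.
Proof.
move=> gA lQ; rewrite -card_blocks => cT.
have [e [fe emax]] := frame_max gA cT (fun t t' => (tag t < tag t')%N) lQ.
have [V [oV eV]] := frame_family fe.
have Vmax V' : orth_family A W n V' -> mutual_sum A Q V' <= mutual_sum A Q V.
  move=> /(family_frame gA)[e' [fe' eV']].
  by rewrite (mutual_sumE gA lQ eV) (mutual_sumE gA lQ eV'); exact: emax.
exists V; split=> //; split=> //; apply: sup_max; first by exists V.
by move=> _ [V' oV' <-]; exact: Vmax.
Qed.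

(** * From single families to the suprema *)

Section PointwiseMain.
Context {R : realType} {m p : nat}.
Variables (A : 'M[R]_m) (Ab : 'M[R]_p).
Hypotheses (gA : gram_mx A) (gAb : gram_mx Ab).
Variable h : 'rV[R]_m -> 'rV[R]_m -> 'rV[R]_p.
Hypothesis hr : forall u, linear (h u).
Hypothesis hC : forall u v, h u v = h v u.
Variable W : {vspace 'rV[R]_m}.

(** The squared norm of a trace is the sum of <h(e_t,e_t), h(e_t',e_t')> over all pairs, hence
    bounded by [frame_max]. The slots of [Q] are arranged to fit its pattern. Boundedness is what
    lets the supremum dominate its members. *)
Lemma trace_form_bounded s : (s <= \dim W)%N ->
  exists M, forall V, (V <= W)%VS -> \dim V = s -> vnorm Ab (trace_form A h V) <= M.
Proof.
move=> sW; pose Q u1 u2 u3 u4 := ip Ab (h u1 u4) (h u2 u3).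
have hl v : linear (h ^~ v) by move=> a u w; rewrite !(hC _ v) hr.
have lQ : quadrilinear Q.
  split=> [b c d|a c d|a b d|a b c] r u v; rewrite /Q.
  - have /= -> := hl d r u v; exact: ip_linl.
  - have /= -> := hl c r u v; exact: ip_linr.
  - have /= -> := hr b r u v; exact: ip_linr.
  - have /= -> := hr a r u v; exact: ip_linl.
have cs : (#|'I_s| <= \dim W)%N by rewrite card_ord.
have [e0 [_ emax]] := frame_max gA cs (fun _ _ => true) lQ.
exists (Num.sqrt (\sum_t \sum_t' Q (e0 t) (e0 t') (e0 t') (e0 t))) => V VW dV.
have [bV oV] := onbP gA V.
have sV : size (onb A V) = s by rewrite (size_onb (conj bV oV)).
rewrite /vnorm; apply: ler_wsqrtr.
apply: le_trans (emax (fun i => (onb A V)`_i) _); last first.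
  split=> [t|t t']; last by rewrite oV ?sV.
  by apply: (subvP VW); apply: (basis_mem bV); apply: mem_nth; rewrite sV.
rewrite /trace_form (big_nth 0) sV big_mkord ip_suml le_eqVlt; apply/orP; left.
by apply/eqP/eq_bigr => i _; rewrite ip_sumr.
Qed.

Variable df : {linear 'rV[R]_m -> 'rV[R]_p}.
Hypothesis iso : forall u v, ip Ab (df u) (df v) = ip A u v.
Variable Wb : {vspace 'rV[R]_p}.
Hypothesis dfW : forall u, u \in W -> df u \in Wb.
Variable Q : 'rV[R]_m -> 'rV[R]_m -> 'rV[R]_m -> 'rV[R]_m -> R.
Variable Qb : 'rV[R]_p -> 'rV[R]_p -> 'rV[R]_p -> 'rV[R]_p -> R.
Hypotheses (lQ : quadrilinear Q) (lQb : quadrilinear Qb).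
Hypothesis gauss : forall u v, Q u v v u =
  Qb (df u) (df v) (df v) (df u) + ip Ab (h u u) (h v v) - ip Ab (h u v) (h u v).

(** An isometric linear map is injective, as kernel vectors have length zero, so images keep their
    dimensions and compete in the target maximum. *)
Lemma orth_family_image k (n : 'I_k -> nat) V : orth_family A W n V ->
  orth_family Ab Wb n (fun a => (linfun df @: V a)%VS).
Proof.
move=> [VW dV oV]; split=> [a|a|a b ab _ _ /memv_imgP[u ua ->] /memv_imgP[v vb ->]].
- apply/subvP => _ /memv_imgP[u ua ->]; rewrite lfunE; apply: dfW.
  exact: (subvP (VW a)).
- rewrite -dV limg_dim_eq//; apply/eqP; rewrite -subv0; apply/subvP => u.
  rewrite memv_cap memv_ker memv0 lfunE /= => /andP[_ /eqP u0].
  by apply/eqP/(ip_eq0 gA); rewrite -iso u0 ip0l.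
- by rewrite !lfunE iso; exact: oV ab _ _ ua vb.
Qed.

Lemma mutual_sup_inequality k (n : 'I_k -> nat) s d :
  (2 <= k)%N -> (\sum_a n a)%N = s -> \dim W = d -> (s <= d)%N ->
  let delta := sup [set mutual_sum A Q V | V in orth_family A W n] in
  let deltab := sup [set mutual_sum Ab Qb V | V in orth_family Ab Wb n] in
  let hmax := sup [set vnorm Ab (trace_form A h V) |
    V in [set V : {vspace 'rV[R]_m} | (V <= W)%VS /\ \dim V = s]] in
  let bound := deltab + (k%:R - 1) / (2 * k%:R) *
    (if (s < d)%N then hmax ^+ 2 else vnorm Ab (trace_form A h W) ^+ 2) in
  delta <= bound /\
  (delta = bound <-> exists V, orth_family A W n V /\
    [/\ mixed h V,
        forall a b, trace_form A h (V a) = trace_form A h (V b),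
        vnorm Ab (trace_form A h (\sum_a V a)%VS) = hmax &
        mutual_sum Ab Qb (fun a => (linfun df @: V a)%VS) = deltab]).
Proof.
move=> k2 sn dW sd delta deltab hmax bound.
have k0 : (0 < k)%N by exact: ltnW.
have snW : (\sum_a n a <= \dim W)%N by rewrite sn dW.
have [V0 [oV0 [dE V0max]]] := mutual_sum_max gA lQ snW.
(* The target fibre is large enough because [df] embeds [W] into it. *)
have snWb : (\sum_a n a <= \dim Wb)%N.
  rewrite (leq_trans snW)// -(limg_dim_eq (_ : W :&: lker (linfun df) = 0)%VS).
    by apply: dimvS; apply/subvP => _ /memv_imgP[u uW ->]; rewrite lfunE; exact: dfW.
  apply/eqP; rewrite -subv0; apply/subvP => u.
  rewrite memv_cap memv_ker memv0 lfunE /= => /andP[_ /eqP u0].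
  by apply/eqP/(ip_eq0 gA); rewrite -iso u0 ip0l.
have [Vb [_ [dbE Vbmax]]] := mutual_sum_max gAb lQb snWb.
have sumW V : orth_family A W n V -> (\sum_a V a <= W)%VS /\ \dim (\sum_a V a)%VS = s.
  move=> oV; have [VW _ _] := oV; split; first by apply/subv_sumP => a _; exact: VW.
  have [e [fe oe]] := family_frame gA oV.
  by rewrite -(size_onb (family_sum_basis fe oe)) size_map -cardE card_blocks.
have sW : (s <= \dim W)%N by rewrite dW.
have [M HM] := trace_form_bounded sW.
have hub V : (V <= W)%VS -> \dim V = s -> vnorm Ab (trace_form A h V) <= hmax.
  move=> VW dV; apply: ub_le_sup; last by exists V.
  by exists M => _ [V' [V'W dV'] <-]; exact: HM.
pose c : R := (k%:R - 1) / (2 * k%:R).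
(* Strict because [k] is at least 2; this allows cancelling [c] in the equality case. *)
have c0 : 0 < c.
  by rewrite divr_gt0// ?subr_gt0 ?ltr1n// mulr_gt0// ltr0n.
have sq V : ip Ab (trace_form A h V) (trace_form A h V) =
  vnorm Ab (trace_form A h V) ^+ 2.
  by rewrite sqr_sqrtr// ip_ge0.
pose B := if (s < d)%N then hmax ^+ 2 else vnorm Ab (trace_form A h W) ^+ 2.
have norm0 V : 0 <= vnorm Ab (trace_form A h V) by exact: sqrtr_ge0.
have BV V : orth_family A W n V ->
    vnorm Ab (trace_form A h (\sum_a V a)%VS) ^+ 2 <= B /\
    (vnorm Ab (trace_form A h (\sum_a V a)%VS) ^+ 2 = B <->
     vnorm Ab (trace_form A h (\sum_a V a)%VS) = hmax).
  move=> oV; have [VW dV] := sumW V oV; rewrite /B; case: ltnP => sd'.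
    have le := hub _ VW dV; have hmax0 := le_trans (norm0 _) le.
    split; first by rewrite ler_sqr ?nnegrE.
    by split=> [/eqP|->//]; rewrite eqrXn2// => /eqP.
  (* Here s = d, so the sum fills [W], and [hmax] is the supremum of a single value. *)
  have VE : (\sum_a V a)%VS = W.
    by apply/eqP; rewrite eqEdim VW dV dW.
  rewrite VE; split=> //; split=> // _; symmetry; apply: sup_max.
    by exists W => //=; rewrite dW; split=> //; apply/eqP; rewrite eqn_leq sd sd'.
  move=> _ [V' [V'W dV'] <-]; suff -> : V' = W by [].
  by apply/eqP; rewrite eqEdim V'W dV' dW.
have deltabE V : orth_family A W n V ->
    mutual_sum Ab Qb (fun a => (linfun df @: V a)%VS) <= deltab.
  by move=> oV; rewrite /deltab dbE; apply: Vbmax; exact: orth_family_image.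
have deltaE V : orth_family A W n V -> mutual_sum A Q V <= delta.
  by move=> oV; rewrite /delta dE; exact: V0max.
have gaussV V : orth_family A W n V ->
    mutual_sum A Q V <= bound /\
    (mutual_sum A Q V = bound <->
    [/\ mixed h V,
        forall a b, trace_form A h (V a) = trace_form A h (V b),
        vnorm Ab (trace_form A h (\sum_a V a)%VS) = hmax &
        mutual_sum Ab Qb (fun a => (linfun df @: V a)%VS) = deltab]).
  move=> oV; have [D SV [D0 DE]] := mutual_gauss gA gAb iso lQ lQb hr hC gauss k0 oV.
  have [leB eqB] := BV V oV; have lb := deltabE V oV.
  rewrite SV sq /bound -/B -/c.
  move: leB eqB lb; set x := _ ^+ 2; set y := mutual_sum _ _ _ => leB eqB lb.
  have cx : c * x <= c * B by rewrite ler_pM2l.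
  split; first by lra.
  split=> [e|[m1 m2 m3 m4]].
    (* The slacks [D], [deltab - y] and [c * B - c * x] are nonnegative with sum zero. *)
    have D00 : D = 0 by lra.
    have yd : y = deltab by lra.
    have xB : x = B by apply: (mulfI (lt0r_neq0 c0)); lra.
    by have [m1 m2] := DE.1 D00; split=> //; exact: eqB.1.
  have -> : D = 0 by apply/DE; split.
  by rewrite m4 (eqB.2 m3) subr0.
split; first by rewrite /delta dE; exact: (gaussV V0 oV0).1.
split=> [e|[V [oV HV]]].
  by exists V0; split=> //; apply: (gaussV V0 oV0).2.1; rewrite -e /delta dE.
apply/eqP; rewrite eq_le; apply/andP; split.
  by rewrite /delta dE; exact: (gaussV V0 oV0).1.
(* A family meeting the conditions has mutual sum [bound], which therefore cannot exceed [delta]. *)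
by rewrite -((gaussV V oV).2.2 HV); exact: deltaE.
Qed.

End PointwiseMain.

(** * Transfer to the manifolds *)

Lemma smooth_on_subset (R : realType) (V W : normedModType R) (U U' : set V)
    (F : V -> W) : U `<=` U' -> smooth_on U' F -> smooth_on U F.
Proof.
move=> UU' sF k; move: (sF k); elim: k F {sF} => [|k IH] F /=.
  by move=> cF y /UU'; exact: cF.
by move=> [dF DF]; split=> [y /UU'|v]; [exact: dF|exact: IH].
Qed.

Section Charts.
Context {R : realType} {m : nat} {M : manifold R m} (i : chart_index M).

(** Within the open chart image this set is the preimage of [O] under the continuous [param]. *)
Lemma open_coord_image (O : set M) : open O -> open (Defs.coord (atlas i) @` (dom
  (atlas i) `&` O)).
Proof.
move=> oO; rewrite openE => _ [x [dx Ox] <-].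
have cx : chart_image i (Defs.coord (atlas i) x) by exists x.
have n1 : nbhs (Defs.coord (atlas i) x) (chart_image i).
  by apply: open_nbhs_nbhs; split=> //; exact: image_open.
have n2 : \forall z \near Defs.coord (atlas i) x, O (param (atlas i) z).
  apply: (param_continuous cx); rewrite coordK//; exact: open_nbhs_nbhs.
apply: filterS2 n1 n2 => _ [x' dx' <-]; rewrite coordK// => Ox'.
by exists x'.
Qed.

Variable g : metric M.

Lemma riemannian_on_chart : riemannian_on (chart_image i) (gram g i).
Proof.
split; first exact: image_open.
- exact: gram_smooth.
- by move=> y cy; split; [exact: gram_sym|exact: gram_posdef].
Qed.

Lemma gram_mx_at x : dom (atlas i) x -> gram_mx (gram_at g i x).
Proof. by move=> dx; have [_ _] := riemannian_on_chart; apply; exists x. Qed.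

(** The (0,4) curvature tensor, ordered so that its value at [u v v u] is the numerator of
    [sectional]. *)
Definition curvature_form x a b c d :=
  ip (gram_at g i x) (curv (gram g i) (Defs.coord (atlas i) x) a b c) d.

Lemma curvature_form_quadrilinear x :
  dom (atlas i) x -> quadrilinear (curvature_form x).
Proof.
by move=> dx; apply: (curv_quadrilinear riemannian_on_chart); exists x.
Qed.

(** Vectors of orthonormal bases of two distinct members are orthonormal together, so the sectional
    denominators equal 1. *)
Lemma mutual_curvatureE x W k (n : 'I_k -> nat) V : dom (atlas i) x ->
  orth_family (gram_at g i x) W n V ->
  mutual_curvature g i x V = mutual_sum (gram_at g i x) (curvature_form x) V.
Proof.
move=> dx [_ _ oV]; have gA := gram_mx_at dx.
apply: eq_bigr => a _; apply: eq_bigr => b ab.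
have ba : a != b by rewrite neq_ltn ab.
have on c u : u \in onb (gram_at g i x) (V c) -> u \in V c /\ ip (gram_at g i x) u u
  = 1.
  move=> uc; have [bV oVc] := onbP gA (V c); split; first exact: (basis_mem bV).
  have su : (index u (onb (gram_at g i x) (V c)) < size (onb (gram_at g i x) (V
    c)))%N by rewrite index_mem.
  by have := oVc _ _ su su; rewrite nth_index// eqxx.
apply: eq_big_seq => u /on[ua uu]; apply: eq_big_seq => v /on[vb vv].
rewrite /sectional -/(gram_at g i x) uu vv (oV a b ba u v ua vb) expr0n subr0 mulr1
  divr1.
by rewrite /curvature_form unlock.
Qed.

Lemma mutual_deltaE x d (D : tangent_distribution M d) k (n : 'I_k -> nat) :
  dom (atlas i) x ->
  mutual_delta g D i x n =
  sup [set mutual_sum (gram_at g i x) (curvature_form x) V |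
    V in orth_family (gram_at g i x) (fibre_at D i x) n].
Proof.
move=> dx; rewrite /mutual_delta; congr sup; apply: eq_imagel => V oV.
exact: mutual_curvatureE oV.
Qed.

End Charts.

(** * The immersion in a pair of charts *)

Section Immersion.
Context {R : realType} {m p : nat} {M : manifold R m} {Mb : manifold R p}.
Variables (g : metric M) (gb : metric Mb) (f : M -> Mb).
Hypotheses (sf : smooth_map f) (isof : isometric g gb f).
Variables (i : chart_index M) (j : chart_index Mb).

Let U := Defs.coord (atlas i) @` (dom (atlas i) `&` f @^-1` dom (atlas j)).
Let F := local_rep f i j.

Lemma local_repE x : dom (atlas i) x -> F (Defs.coord (atlas i) x) =
  Defs.coord (atlas j) (f x).
Proof. by move=> dx; rewrite /F /local_rep /= coordK. Qed.

Lemma local_metric : riemannian_on U (gram g i).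
Proof.
have [oc sc pc] := riemannian_on_chart i g.
have UC : U `<=` chart_image i by move=> _ [x [dx _] <-]; exists x.
split; [|exact: smooth_on_subset sc|by move=> y /UC; exact: pc].
apply: open_coord_image; apply: open_comp; last exact: dom_open.
by move=> x _; exact: (sf.1 x).
Qed.

Lemma local_smooth : smooth_on U F. Proof. exact: sf.2. Qed.

Lemma local_chart_image y : U y -> chart_image j (F y).
Proof. by move=> [x [dx dfx] <-]; exists (f x) => //; rewrite local_repE. Qed.

Lemma local_diffE y u : U y -> 'd F y u = dd u F y.
Proof. by move=> Uy; rewrite ddE deriveE//; exact: smooth_on_differentiable
  local_smooth Uy. Qed.

Lemma local_isometry y : U y -> forall u v,
  ip (gram gb j (F y)) (dd u F y) (dd v F y) = ip (gram g i y) u v.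
Proof.
move=> Uy u v; rewrite -!local_diffE//; case: Uy => x [dx dfx] <-.
by rewrite local_repE//; exact: isof.
Qed.

Variable x : M.
Hypotheses (hi : dom (atlas i) x) (hj : dom (atlas j) (f x)).

Let Ux : U (Defs.coord (atlas i) x). Proof. by exists x. Qed.

(** ['d F z v] and [dd v F z] agree on the open set [U], hence so do their derivatives. *)
Lemma second_ffE u v : second_ff g gb f i j x u v =
  sff (gram g i) (gram gb j) F (Defs.coord (atlas i) x) u v.
Proof.
have [oU _ _] := local_metric.
have e : dd u (dd v F) (Defs.coord (atlas i) x) =
    'D_u (fun z => 'd F z v) (Defs.coord (atlas i) x).
  by rewrite ddE; apply: derive_eq_on oU Ux _ => z Uz; rewrite -local_diffE.
rewrite /sff /nab e !chrE -(local_diffE u Ux) -(local_diffE v Ux) -(local_diffE _ Ux).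
by rewrite /second_ff /second_ff_loc /nabla_along /nabla derive_cst add0r.
Qed.

Lemma second_ff_linr u : linear (second_ff g gb f i j x u).
Proof.
move=> a v w; rewrite !second_ffE.
exact: (sff_linr local_metric (riemannian_on_chart j gb) local_smooth
  local_chart_image).
Qed.

Lemma second_ffC u v : second_ff g gb f i j x u v = second_ff g gb f i j x v u.
Proof.
rewrite !second_ffE.
exact: (sffC local_metric (riemannian_on_chart j gb) local_smooth local_chart_image).
Qed.

Lemma gauss_curvature_form u v :
  curvature_form i g x u v v u =
  curvature_form j gb (f x) (diff_at f i j x u) (diff_at f i j x v)
    (diff_at f i j x v) (diff_at f i j x u)
  + ip (gram_at gb j (f x)) (second_ff g gb f i j x u u) (second_ff g gb f i j x v v)
  - ip (gram_at gb j (f x)) (second_ff g gb f i j x u v) (second_ff g gb f i j x u v).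
Proof.
rewrite (second_ffE u u) (second_ffE v v) (second_ffE u v).
have e := gauss_equation local_metric (riemannian_on_chart j gb) local_smooth
  local_chart_image local_isometry u v v u Ux.
have e2 w : diff_at f i j x w = dd w F (Defs.coord (atlas i) x) by exact: local_diffE.
have c := sffC local_metric (riemannian_on_chart j gb) local_smooth local_chart_image
  v u Ux.
rewrite /curvature_form /gram_at !e2 -(local_repE hi) e c.
have [gs _] := gram_mx_at gb hj.
rewrite (ipC (sff _ _ _ _ v v) _ (_ : _ = _)); first by ring.
by rewrite local_repE.
Qed.

End Immersion.

Theorem theorem4p1 (R : realType) (m p d db : nat)
  (M : manifold R m) (g : metric M) (D : tangent_distribution M d)
  (Mb : manifold R p) (gb : metric Mb) (Db : tangent_distribution Mb db)
  (f : M -> Mb) (hf : adapted_isometric_immersion g D gb Db f)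
  (k s : nat) (n : 'I_k -> nat)
  (hk : (2 <= k)%N) (hn : forall a, (1 <= n a)%N)
  (hs : (\sum_(a < k) n a)%N = s) (hsd : (s <= d)%N)
  (x : M) (i : chart_index M) (j : chart_index Mb)
  (hi : dom (atlas i) x) (hj : dom (atlas j) (f x)) :
  let bound :=
    mutual_delta gb Db j (f x) n +
    (k%:R - 1) / (2 * k%:R) *
      (if (s < d)%N then max_mean_curv g D gb f i j x s ^+ 2
       else mean_curv_norm g gb f i j x (fibre_at D i x) ^+ 2) in
  mutual_delta g D i x n <= bound /\
  (mutual_delta g D i x n = bound <->
   exists V : 'I_k -> {vspace 'rV[R]_m},
     orth_family (gram_at g i x) (fibre_at D i x) n V /\
     [/\ mixed_totally_geodesic g gb f i j x V,
         forall a b,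
           mean_curv g gb f i j x (V a) = mean_curv g gb f i j x (V b),
         mean_curv_norm g gb f i j x (\sum_(a < k) V a)%VS =
           max_mean_curv g D gb f i j x s &
         mutual_curvature gb j (f x) (fun a => push f i j x (V a)) =
           mutual_delta gb Db j (f x) n]).
Proof.
have [[sf _] isof adf] := hf.
have gA := gram_mx_at g hi; have gAb := gram_mx_at gb hj.
have dW : \dim (fibre_at D i x) = d by apply: fibre_rank; exists x.
have iso := isof i j x hi hj.
have dfW := adf i j x hi hj.
have lQ := curvature_form_quadrilinear g hi.
have lQb := curvature_form_quadrilinear gb hj.
have [le eq] := mutual_sup_inequality gA gAb (second_ff_linr g gb sf hi hj)
  (second_ffC g gb sf hi hj) iso dfW lQ lQb (gauss_curvature_form sf isof hi hj)
  hk hs dW hsd.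
rewrite !mutual_deltaE//; split; first exact: le.
apply: (iff_trans eq); split=> -[V [oV [m1 m2 m3 m4]]]; exists V; split=> //; split=> //.
  (* The pushed family is orthogonal by [orth_family_image], so its mutual curvature is again a
     [mutual_sum]. *)
  by rewrite (mutual_curvatureE hj (orth_family_image gA iso dfW oV)).
by rewrite -(mutual_curvatureE hj (orth_family_image gA iso dfW oV)).
Qed.
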